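(* Let $X=X(\mathcal{M},\mathcal{C})$ be a twisted 2-stratifold and let $K$ be a triangulation of $X$. If $f:K\to\mathbb{R}$ is a discrete Morse function, then $m_2(f)\ge|\mathcal{M}|$.
   Context: A (finite) 2-stratifold $X=X(\mathcal{M},\mathcal{C})$ is a compact connected Hausdorff space obtained from a finite collection $\mathcal{C}$ of circles and a finite collection $\mathcal{M}=\{\mathbb{M}_1,\dots,\mathbb{M}_n\}$ of compact connected surfaces with boundary by attaching each boundary component of each $\mathbb{M}_i$ to exactly one circle via a covering map $\mathbb{S}^1\to\mathbb{S}^1$ of some degree, where for each circle the sum of the absolute values of the degrees of the maps attached to it exceeds $2$. $X$ is twisted if every attaching map has degree different from $\pm1$. A discrete Morse function on a simplicial complex $K$ is $f:K\to\mathbb{R}$ such that for every $i$-simplex $\sigma$ at most one $(i+1)$-simplex $\tau>\sigma$ has $f(\tau)\le f(\sigma)$ and at most one $(i-1)$-face $\tau<\sigma$ has $f(\tau)\ge f(\sigma)$; $\sigma$ is critical if both counts are $0$, and $m_2(f)$ is the number of critical $2$-simplices. *)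

(* Defs.v *)
From HB Require Import structures.
From mathcomp Require Import all_boot all_order all_algebra.
From mathcomp Require Import all_classical all_reals all_analysis.
Set Implicit Arguments. Unset Strict Implicit. Unset Printing Implicit Defensive.
Import Order.TTheory GRing.Theory Num.Theory.
Import numFieldNormedType.Exports.
Local Open Scope classical_set_scope.
Local Open Scope ring_scope.

Section TopDefs.
Variable R : realType.

Definition S1 : set (R * R) := [set p | p.1 ^+ 2 + p.2 ^+ 2 = 1].
Definition halfplane : set (R * R) := [set p | 0 <= p.2].

Definition relopen {T : topologicalType} (A B : set T) :=
  exists W : set T, open W /\ B = W `&` A.

Definition homeo_onto {A B : topologicalType} (U : set A) (g : A -> B)
    (V : set B) :=
  [/\ {in U &, injective g}, g @` U = V, {within U, continuous g} &
      forall U' : set A, open U' -> relopen V (g @` (U' `&` U))].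

Definition surface_chart {T : topologicalType} (U : set T) (g : T -> R * R) :=
  open U /\ exists W : set (R * R), open W /\ homeo_onto U g (W `&` halfplane).

Definition surface_with_boundary (T : topologicalType) :=
  forall x : T, exists U g, U x /\ surface_chart U g.

Definition sbdry (T : topologicalType) : set T :=
  [set x | exists U g, [/\ U x, surface_chart U g & (g x).2 = 0]].

Arguments sbdry : clear implicits.

Definition compact_connected_surface (T : topologicalType) :=
  [/\ hausdorff_space T, compact [set: T], connected [set: T],
      [set: T] !=set0 & surface_with_boundary T].

Definition covering_map {T : topologicalType} (B : set T) (p : T -> R * R)
    (S : set (R * R)) :=
  [/\ p @` B = S, {within B, continuous p} &
      forall s, S s -> exists V : set (R * R),
        [/\ relopen S V, V s &
          exists F : set (set T),
           [/\ forall U, F U -> relopen B U /\ homeo_onto U p V,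
               forall U U', F U -> F U' -> U `&` U' !=set0 -> U = U' &
               B `&` (p @^-1` V) = \bigcup_(U in F) U]]].

(** Twisted 2-stratifold X = X(M, C) with n surfaces M_0..M_{n-1} and
    m circles C_0..C_{m-1} (each a copy of S1).  [phi i] is the attaching
    map on the boundary of M_i (giving circle index and point on S1),
    [q i : M i -> X] and [c j : S1 -> X] are the maps into the quotient. *)
Definition twisted_2_stratifold (X : topologicalType) (n m : nat)
    (M : 'I_n -> topologicalType)
    (phi : forall i, M i -> 'I_m * (R * R))
    (q : forall i, M i -> X) (c : 'I_m -> R * R -> X) : Prop :=
  [/\
   [/\ hausdorff_space X, compact [set: X] & connected [set: X]] /\
   (forall i, compact_connected_surface (M i)),
   (forall i (x : M i), sbdry (M i) x ->
      let B := connected_component (sbdry (M i)) x in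
      (forall y, B y -> (phi i y).1 = (phi i x).1) /\
      covering_map B (fun y => (phi i y).2) S1),
   (* for each circle the sum of |degrees| of maps attached exceeds 2;
      (the sum of |degrees| is the cardinality of the total fibre) *)
   (forall (j : 'I_m) p, S1 p ->
      let fib (u : {i : 'I_n & M i}) :=
        sbdry (M (projT1 u)) (projT2 u) /\ phi (projT1 u) (projT2 u) = (j, p) in
      exists u1 u2 u3, [/\ fib u1, fib u2, fib u3 &
                           [/\ u1 <> u2, u1 <> u3 & u2 <> u3]]),
   (* twisted: no attaching map has degree +-1, i.e. every fibre of the
      covering of each boundary component has at least two points *)
   (forall i (x : M i), sbdry (M i) x ->
      exists y, [/\ connected_component (sbdry (M i)) x y, y <> x &
                    phi i y = phi i x]) &
   (* X is the adjunction space: quotient of (disjoint union of the M_i)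
      + (disjoint union of the circles) by x ~ phi(x) on boundaries *)
   [/\ (forall z : X, (exists i x, q i x = z) \/ (exists j p, S1 p /\ c j p = z)),
       (forall i (x : M i), sbdry (M i) x -> q i x = c (phi i x).1 (phi i x).2),
       (forall i (x : M i) i' (y : M i'), q i x = q i' y ->
           existT M i x = existT M i' y \/
           [/\ sbdry (M i) x, sbdry (M i') y & phi i x = phi i' y]),
       (forall j j' p p', S1 p -> S1 p' -> c j p = c j' p' -> j = j' /\ p = p') &
       (
       (forall i (x : M i) j p, S1 p -> q i x = c j p -> sbdry (M i) x) /\
       (forall U : set X, open U <->
          ((forall i, open (q i @^-1` U)) /\
           (forall j, relopen S1 (S1 `&` (c j @^-1` U))))))]].

End TopDefs.

Definition simplicial_complex (N : nat) (K : {set {set 'I_N}}) :=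
  (forall s, s \in K -> s != finset.set0) /\
  (forall s t : {set 'I_N}, s \in K -> t \subset s -> t != finset.set0 -> t \in K).

Definition geom_real (R : realType) (N : nat) (K : {set {set 'I_N}}) :
    set 'rV[R]_N :=
  fun v : 'rV[R]_N => [/\ forall k, 0 <= v 0 k, \sum_k v 0 k = 1 &
              finset.finset (fun k => v 0 k != 0) \in K].

Definition discrete_morse (R : realType) (N : nat) (K : {set {set 'I_N}})
    (f : {set 'I_N} -> R) :=
  forall s, s \in K ->
    (#|[set t in K | (s \subset t) && (#|t| == #|s|.+1) && (f t <= f s)%R]| <= 1)%N /\
    (#|[set t in K | (t \subset s) && (#|t|.+1 == #|s|) && (f s <= f t)%R]| <= 1)%N.

Definition critical (R : realType) (N : nat) (K : {set {set 'I_N}})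
    (f : {set 'I_N} -> R) (s : {set 'I_N}) :=
  (#|[set t in K | (s \subset t) && (#|t| == #|s|.+1) && (f t <= f s)%R]| == 0)%N &&
  (#|[set t in K | (t \subset s) && (#|t|.+1 == #|s|) && (f s <= f t)%R]| == 0)%N.

Definition m2 (R : realType) (N : nat) (K : {set {set 'I_N}})
    (f : {set 'I_N} -> R) : nat :=
  #|[set s in K | (#|s| == 3)%N && critical K f s]|.

(* Main.v *)
Require Import Defs.
From HB Require Import structures.
From mathcomp Require Import all_boot all_order all_algebra.
From mathcomp Require Import all_classical all_reals all_analysis.
From mathcomp Require Import ring lra zify.
Import Order.TTheory GRing.Theory Num.Theory.
Import numFieldNormedType.Exports.
Set Implicit Arguments. Unset Strict Implicit. Unset Printing Implicit Defensive.

(** Let T_i be the set of triangles whose open cell lies in the image of M_i.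
    A triangle of T_i with the largest value of f is critical: a face e of it
    with f(e) >= f(t) lies in another triangle t' of T_i, and f(t') > f(e) by
    the Morse condition at e. So it suffices that the T_i are nonempty and
    disjoint, that no simplex has dimension 3 or more, and that every edge of
    a triangle of T_i lies in a second triangle of T_i.

    All of this follows from invariance of domain in the plane, because X being
    twisted makes every point of M_i, including those on the singular circles,
    the center of an injectively embedded disc in the image of M_i: at a point
    of a circle two half discs of M_i, at different points of the same fibre,
    are glued along their diameters. The circles therefore need not be shown to
    form a subcomplex.

    Invariance of domain is obtained from Sperner's lemma. If the image of the
    square missed points arbitrarily close to the image of the center, the
    three-colour closed cover of the square by sectors, whose only triple point
    is the center, could be recoloured near the center without triple points. *)

(** * Sperner's lemma on a square grid *)

Section Grid.

Let door (a b : nat) : bool := (a == 1) && (b == 2) || (a == 2) && (b == 1).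

(* Sperner's parity argument, strip by strip: the number of edges labelled 1-2
   on a vertical grid line has the same parity on all lines. *)
Lemma grid_three_labels (n : nat) (l : nat -> nat -> nat) :
  (forall i j, l i j < 3) ->
  (forall j, j <= n -> l 0 j = 0) -> (forall i, i <= n -> l i 0 != 1) ->
  (forall i, i <= n -> l i n != 2) -> (forall j, j <= n -> l n j != 0) ->
  exists i j, [/\ i < n, j < n & forall k, k < 3 ->
    k \in [:: l i j; l i.+1 j; l i j.+1; l i.+1 j.+1]].
Proof.
move=> l3 lL lB lT lR; apply/not_existsP => H.
pose V i t := \big[addb/false]_(j < t) door (l i j) (l i j.+1).
(* A cell that misses a label has an even number of 1-2 edges on its boundary: if it misses 0, going
   around it changes the label an even number of times; otherwise there is no such edge. *)
have cell i j : i < n -> j < n ->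
    door (l i j) (l i j.+1) (+) door (l i.+1 j) (l i.+1 j.+1) =
    door (l i j) (l i.+1 j) (+) door (l i j.+1) (l i.+1 j.+1).
  move=> i_n j_n; have := H i; rewrite -forallNP => /(_ j).
  rewrite (_ : [/\ _, _ & _] = forall k, k < 3 ->
    k \in [:: l i j; l i.+1 j; l i j.+1; l i.+1 j.+1]); last first.
    by apply/propext; split=> [[]//|].
  have := l3 i.+1 j.+1; have := l3 i.+1 j; have := l3 i j.+1; have := l3 i j.
  move: (l i j) (l i.+1 j) (l i j.+1) (l i.+1 j.+1).
  do 4![case=> [|[|[|//]]]] => _ _ _ _ //= K; exfalso;
    by apply: K; case=> [|[|[|//]]].
have strip i t : i < n -> t <= n ->
    V i t (+) V i.+1 t = door (l i 0) (l i.+1 0) (+) door (l i t) (l i.+1 t).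
  move=> i_n; elim: t => [|t IH] t_n.
    by rewrite /V !big_ord0 !addbb.
  rewrite /V !big_ord_recr /= addbACA -/(V i t) -/(V i.+1 t) IH 1?ltnW //.
  by rewrite cell // -addbA [door (l i t) _ (+) _]addbA addbb.
(* The bottom side has no label 1 and the top side no label 2, so neither carries a 1-2 edge. *)
have VE i : i <= n -> V i n = V 0 n.
  elim: i => // i IH i_n; rewrite -(IH (ltnW i_n)).
  have := strip i n i_n (leqnn n).
  have := lB i (ltnW i_n); have := lB i.+1 i_n.
  have := lT i (ltnW i_n); have := lT i.+1 i_n.
  rewrite {1 2}/door => /negbTE -> /negbTE -> /negbTE -> /negbTE ->.
  by rewrite /= !andbF; case: (V i n); case: (V i.+1 n).
have V0 : V 0 n = false.
  by rewrite /V big1// => j _; rewrite lL//; rewrite ltnW.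
(* The right side has labels 1 and 2 only, so its 1-2 edges are the label changes. It starts with 2
   and ends with 1: an odd number, against none on the left side. *)
have VR t : t <= n -> V n t = (l n 0 == 2) (+) (l n t == 2).
  elim: t => [|t IH] t_n; first by rewrite /V big_ord0 addbb.
  rewrite /V big_ord_recr /= -/(V n t) IH 1?ltnW //.
  have := lR t (ltnW t_n); have := lR t.+1 t_n.
  have := l3 n t; have := l3 n t.+1; rewrite /door.
  case: (l n t) => [|[|[|//]]]; case: (l n t.+1) => [|[|[|//]]] //= _ _ _ _;
    by case: (l n 0 == 2).
have := VE n (leqnn n); rewrite V0 VR //.
have := l3 n 0; have := lR 0 (leq0n n); have := lB n (leqnn n).
have := lT n (leqnn n) => /negbTE ->.
by case: (l n 0) => [|[|[|//]]].
Qed.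

End Grid.

Local Open Scope classical_set_scope.
Local Open Scope ring_scope.

(** * Invariance of domain in the plane *)

(** Compactness: if there is no common point, each point of [A] is off [B] or off [C], hence has a
    neighborhood and a radius that work there; near-covering gives one radius for all of [A]. *)
Lemma three_close (R : realType) (T : pseudoMetricType R) (A B C : set T) :
  compact A -> closed B -> closed C ->
  (forall e : R, 0 < e -> exists a b c,
     [/\ A a, B b, C c, ball a e b & ball a e c]) ->
  exists p, [/\ A p, B p & C p].
Proof.
move=> cA clB clC H; apply/not_existsP => nE.
have cov := (compact_near_coveringP A).1 cA R (0^'+)%R
  (fun e x => ~ exists b c, [/\ B b, C c, ball x e b & ball x e c]).
have /cov : forall x, A x -> \forall x' \near x & e \near 0^'+,
    ~ exists b c, [/\ B b, C c, ball x' e b & ball x' e c].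
  move=> x Ax.
  have far (D : set T) : closed D -> ~ D x ->
      \forall x' \near x & e \near 0^'+, forall y, D y -> ~ ball x' e y.
    move=> clD nDx; have /nbhs_ballP[r /= r0 rD] : nbhs x (~` D).
      by apply: open_nbhs_nbhs; split=> //; exact: closed_openC.
    exists (ball x (r / 2), [set e | 0 < e < r / 2]) => /=.
      split; first by apply: nbhsx_ballx; rewrite divr_gt0.
      near=> e; apply/andP; split; first by [].
      by near: e; apply: nbhs_right_lt; rewrite divr_gt0.
    move=> [x' e] /= [xx' /andP[e0 er]] y Dy x'y.
    apply: (rD y) => //; rewrite [r]splitr; apply: ball_triangle xx' _.
    by apply: le_ball x'y; exact: ltW.
  have [Bx|nBx] := pselect (B x).
    have nCx : ~ C x by move=> Cx; exact: (nE x).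
    by apply: filterS (far C clC nCx) => -[x' e] /= F [b [c [_ Cc _ ac]]]; exact: (F c Cc ac).
  by apply: filterS (far B clB nBx) => -[x' e] /= F [b [c [Bb _ ab _]]]; exact: (F b Bb ab).
move=> nH.
have : \forall e \near 0^'+, 0 < e /\ forall x, A x ->
    ~ exists b c, [/\ B b, C c, ball x e b & ball x e c].
  by near=> e; split => //; near: e; exact: nH.
move=> /(@filter_ex _ _ _)[e [e0 eH]].
by have [a [b [c [Aa Bb Cc ab ac]]]] := H _ e0; apply: (eH a) => //; exists b, c.
Unshelve. all: by end_near. Qed.

(** * Closed three-colour covers of the square *)

Section Square.
Variable R : realType.
Implicit Types p : R * R.

Definition square : set (R * R) :=
  [set p | -1 <= p.1 <= 1 /\ -1 <= p.2 <= 1].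

Lemma squareE : square = `[-1, 1]%classic `*` `[-1, 1]%classic.
Proof. by apply/seteqP; split => p /=; rewrite !in_itv. Qed.

Lemma compact_square : compact square.
Proof. by rewrite squareE; apply: compact_setX; exact: segment_compact. Qed.

Lemma closed_square : closed square.
Proof. by apply: compact_closed compact_square; exact: norm_hausdorff. Qed.

(** The closed-set form of Sperner's lemma: a three-coloured cell in a grid of mesh [2 / n] brings
    the three sets within [e] of each other for every [e], and compactness gives a common point. *)
Lemma square_cover (A B C : set (R * R)) :
  closed A -> closed B -> closed C -> square `<=` A `|` B `|` C ->
  (forall p, square p -> p.1 = -1 -> ~ B p /\ ~ C p) ->
  (forall p, square p -> p.2 = -1 -> ~ B p) ->
  (forall p, square p -> p.2 = 1 -> ~ C p) ->
  (forall p, square p -> p.1 = 1 -> ~ A p) ->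
  exists p, [/\ square p, A p, B p & C p].
Proof.
move=> clA clB clC cov L Bo To Ri.
suff : exists p, [/\ (A `&` square) p, B p & C p].
  by case=> p [[? ?] ? ?]; exists p.
have [|||e e0|p [[Ap Qp] Bp Cp]] := @three_close R _ (A `&` square)
    (B `&` square) (C `&` square).
- by rewrite setIC; apply: compact_closedI => //; exact: compact_square.
- by apply: closedI => //; exact: closed_square.
- by apply: closedI => //; exact: closed_square.
- have [n n0 ne] : exists2 n : nat, (0 < n)%N & 2 / n%:R < e.
    exists (Num.truncn (2 / e)).+1 => //.
    rewrite ltr_pdivrMr ?ltr0n// mulrC -ltr_pdivrMr//.
    exact: truncnS_gt.
  have n0' : 0 < n%:R :> R by rewrite ltr0n.
  pose x i : R := -1 + 2 * (i%:R / n%:R).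
  pose pt i j : R * R := (x i, x j).
  (* Label 2 is the default; at grid points in the square the cover makes it mean membership in
     [C]. *)
  pose l i j : nat := if `[<A (pt i j)>] then 0%N else
    if `[<B (pt i j)>] then 1%N else 2%N.
  have xQ i : (i <= n)%N -> -1 <= x i <= 1.
    move=> i_n; pose u : R := i%:R / n%:R.
    have u01 : 0 <= u <= 1.
      by apply/andP; split; rewrite ?divr_ge0 ?ler0n// ler_pdivrMr// mul1r ler_nat.
    by rewrite /x -/u; lra.
  have x0 : x 0%N = -1 by rewrite /x mul0r mulr0 addr0.
  have xn : x n = 1 by rewrite /x divff ?gt_eqF//; lra.
  have ptQ i j : (i <= n)%N -> (j <= n)%N -> square (pt i j).
    by move=> i_n j_n; split; exact: xQ.
  have lA i j : l i j = 0%N -> A (pt i j).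
    by rewrite /l; case: asboolP => // _; case: ifP.
  have lB i j : l i j = 1%N -> B (pt i j).
    by rewrite /l; case: ifP => // _; case: asboolP.
  have lC i j : (i <= n)%N -> (j <= n)%N -> l i j = 2%N -> C (pt i j).
    move=> i_n j_n; have := cov _ (ptQ i j i_n j_n); rewrite /l.
    case: asboolP => // nA; case: asboolP => // nB.
    by case=> [[]|].
  have l3 i j : (l i j < 3)%N by rewrite /l; case: ifP => //; case: ifP.
  have [||||i [j [i_n j_n lE]]] := @grid_three_labels n l l3.
  + move=> j jn; have [nB nC] := L _ (ptQ _ _ (leq0n n) jn) x0.
    have := l3 0%N j; case: (l 0%N j) (@lB 0%N j) (@lC 0%N j).
      by [].
    by case=> [|[|//]] => [/(_ erefl) /nB|_ /(_ (leq0n n) jn erefl) /nC].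
  + move=> i i_n; apply/eqP => /lB.
    exact: (Bo _ (ptQ _ _ i_n (leq0n n)) x0).
  + move=> i i_n; apply/eqP => /(lC _ _ i_n (leqnn n)).
    exact: (To _ (ptQ _ _ i_n (leqnn n)) xn).
  + move=> j jn; apply/eqP => /lA.
    exact: (Ri _ (ptQ _ _ (leqnn n) jn) xn).
  have xS k : x k.+1 = x k + 2 / n%:R.
    by rewrite /x -(natr1 k); field; rewrite gt_eqF.
  have close i' j' i'' j'' : i' \in [:: i; i.+1] -> i'' \in [:: i; i.+1] ->
      j' \in [:: j; j.+1] -> j'' \in [:: j; j.+1] ->
      ball (pt i' j') e (pt i'' j'').
    have c1 k k' k'' : k' \in [:: k; k.+1] -> k'' \in [:: k; k.+1] ->
        ball (x k') e (x k'').
      have n2 : 0 < 2 / n%:R :> R by rewrite divr_gt0.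
      rewrite !inE => /orP[] /eqP-> /orP[] /eqP->; rewrite /ball /= ?xS.
      * by rewrite subrr normr0.
      * by rewrite opprD addrA subrr add0r normrN gtr0_norm.
      * by rewrite addrC addKr gtr0_norm.
      * by rewrite subrr normr0.
    by move=> Hi' Hi'' Hj' Hj''; split; [exact: c1 Hi' Hi''|exact: c1 Hj' Hj''].
  have pick k : (k < 3)%N -> exists i' j', [/\ i' \in [:: i; i.+1],
      j' \in [:: j; j.+1], (i' <= n)%N, (j' <= n)%N & l i' j' = k].
    have [i_n' j_n'] := (ltnW i_n, ltnW j_n).
    move=> /lE; rewrite !inE => /or4P[] /eqP->.
    - by exists i, j; rewrite !inE !eqxx.
    - by exists i.+1, j; rewrite !inE !eqxx orbT.
    - by exists i, j.+1; rewrite !inE !eqxx orbT.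
    - by exists i.+1, j.+1; rewrite !inE !eqxx !orbT.
  have [i0 [j0 [? ? ? ? /lA ?]]] := pick 0%N isT.
  have [i1 [j1 [? ? ? ? /lB ?]]] := pick 1%N isT.
  have [i2 [j2 [? ? ? ? /(lC i2 j2) ?]]] := pick 2%N isT.
  exists (pt i0 j0), (pt i1 j1), (pt i2 j2).
  by split; [split|split|split| |]; auto.
- by exists p; split => //; [case: Bp|case: Cp].
Qed.

End Square.

Lemma closed_within_preimage (T U : topologicalType) (A : set T) (f : T -> U)
    (D : set U) :
  closed A -> {within A, continuous f} -> closed D ->
  closed (A `&` f @^-1` D).
Proof.
move=> clA /subspace_continuousP cf clD p clp.
have Ap : A p by apply: clA; apply: closureS clp => ? [].
split=> //; apply: contrapT => nD.
have : nbhs (f p) (~` D) by apply: open_nbhs_nbhs; split=> //; exact: closed_openC.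
by move=> /(cf p Ap) /clp [y [[Ay Dy] /(_ Ay)]].
Qed.

Lemma within_continuous_comp (T U V : topologicalType) (A : set T) (B : set U)
    (f : T -> U) (g : U -> V) :
  (forall x, A x -> B (f x)) ->
  {within A, continuous f} -> {within B, continuous g} ->
  {within A, continuous (g \o f)}.
Proof.
move=> AB /subspace_continuousP cf /subspace_continuousP cg.
apply/subspace_continuousP => x Ax W /(cg _ (AB _ Ax)) /(cf x Ax) H.
have {}H : nbhs x (fun y => A y -> B (f y) -> W (g (f y))) := H.
by apply: filterS H => y Hy Ay; apply: (Hy Ay); exact: AB.
Qed.

Lemma within_continuous_post (T U V : topologicalType) (A : set T)
    (f : T -> U) (g : U -> V) :
  {within A, continuous f} -> (forall x, A x -> {for f x, continuous g}) ->
  {within A, continuous (g \o f)}.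
Proof.
move=> /subspace_continuousP cf cg.
by apply/subspace_continuousP => x Ax W /(cg _ Ax) /(cf x Ax).
Qed.

(** * Extending a colouring over a circle without triple points *)

Section Diamond.
Variables (R : realType) (e : R).
Hypothesis e0 : 0 < e.

Definition norm1 (s : R * R) : R := `|s.1| + `|s.2|.
(** The circle is taken in the l1 norm: each of its halves is the graph of [e - |s.1|] or its
    negative, so the first coordinate parametrizes it. *)
Definition diamond : set (R * R) := [set s | norm1 s = e].

Lemma norm1_continuous : continuous norm1.
Proof.
move=> s; apply: cvgD; apply: cvg_norm; [exact: cvg_fst|exact: cvg_snd].
Qed.

Lemma closed_diamond : closed diamond.
Proof.
have -> : diamond = norm1 @^-1` [set e] by [].
exact: (preimage_closed (fun s _ => @norm1_continuous s) (@closed_eq R e)).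
Qed.

(* The diamond is one-dimensional: small pieces of it, indexed by the half
   they lie in and by the nearest multiple of [2 e / n], meet at most two at a
   time. Each piece is given a colour that it already meets. *)
Lemma diamond_cover (C : nat -> set (R * R)) :
  (forall k, (k < 3)%N -> closed (C k)) -> compact (C 0%N) ->
  (forall k, (k < 3)%N -> C k `<=` diamond) ->
  ~ (exists s, [/\ C 0%N s, C 1%N s & C 2%N s]) ->
  exists D : nat -> set (R * R),
    [/\ forall k, (k < 3)%N -> closed (D k),
        forall k, (k < 3)%N -> C k `<=` D k,
        forall s, diamond s -> exists2 k, (k < 3)%N & D k s &
        ~ (exists s, [/\ D 0%N s, D 1%N s & D 2%N s])].
Proof.
move=> clC cC0 CS C012.
(* A scale below which the three colours never come together; the pieces will have width
   [d < r / 2]. *)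
have [r r0 rC] : exists2 r : R, 0 < r & forall a b c,
    C 0%N a -> C 1%N b -> C 2%N c -> ball a r b -> ball a r c -> False.
  apply: contrapT => /forall2NP H; apply: C012.
  apply: three_close; [exact: cC0|exact: clC|exact: clC|].
  move=> r r0; have [//|nH] := H r; apply: contrapT => nE; apply: nH.
  by move=> a b c Ca Cb Cc ab ac; apply: nE; exists a, b, c.
have [n n0 nr] : exists2 n : nat, (0 < n)%N & 2 * e / n%:R < r / 2.
  exists (Num.truncn (2 * e / (r / 2))).+1 => //.
  have r20 : 0 < r / 2 by rewrite divr_gt0.
  rewrite ltr_pdivrMr ?ltr0n// -ltr_pdivrMl// mulrC.
  exact: truncnS_gt.
have n0' : 0 < n%:R :> R by rewrite ltr0n.
pose d := 2 * e / n%:R.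
have d0 : 0 < d by rewrite /d divr_gt0// mulr_gt0.
have nd : n%:R * d = 2 * e by rewrite /d mulrC divfK// gt_eqF.
pose J (b : bool) (k : nat) := diamond `&`
  ([set s | if b then 0 <= s.2 else s.2 <= 0] `&`
   [set s | k%:R * d - d / 2 <= s.1 + e <= k%:R * d + d / 2]).
have clJ b k : closed (J b k).
  apply: closedI; first exact: closed_diamond.
  apply: closedI.
    have c2 : {for _, continuous (snd : R * R -> R)} by move=> s; exact: cvg_snd.
    case: b.
      exact: (preimage_closed (fun s _ => c2 s) (@closed_ge R 0)).
    exact: (preimage_closed (fun s _ => c2 s) (@closed_le R 0)).
  have -> : [set s : R * R | k%:R * d - d / 2 <= s.1 + e <= k%:R * d + d / 2] =
      (fun s => s.1 + e) @^-1` `[k%:R * d - d / 2, k%:R * d + d / 2]%classic.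
    by apply/seteqP; split => s /=; rewrite in_itv.
  apply: preimage_closed => [s _|]; last exact: interval_closed.
  by apply: cvgD; [exact: cvg_fst|exact: cvg_cst].
(* Within one half, [s.2] is a 1-Lipschitz function of [s.1]. *)
have J_small b k s t : J b k s -> J b k t ->
    `|s.1 - t.1| <= d /\ `|s.2 - t.2| <= d.
  move=> [Ss [sb /andP[s1 s2]]] [St [tb /andP[t1 t2]]].
  have D1 : `|s.1 - t.1| <= d by rewrite ler_norml; apply/andP; split; lra.
  split => //; apply: le_trans D1.
  move: Ss St; rewrite /diamond /norm1 /=.
  have : `| `|s.1| - `|t.1| | <= `|s.1 - t.1| by exact: ler_dist_dist.
  move: `|s.1 - t.1| `|s.1| `|t.1| => x y z; rewrite !ler_norml => /andP[? ?].
  case: b sb tb => sb tb; [rewrite !ger0_norm//|rewrite !ler0_norm//].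
    by move=> ? ?; apply/andP; split; lra.
  by move=> ? ?; apply/andP; split; lra.
have J_cover s : diamond s -> exists b k, (k <= n)%N /\ J b k s.
  move=> Ss; exists (0 <= s.2).
  have s1e : 0 <= s.1 + e <= 2 * e.
    have : `|s.1| <= e by move: Ss; rewrite /diamond /norm1/= => <-; rewrite lerDl.
    by rewrite ler_norml => /andP[? ?]; apply/andP; split; lra.
  have [u0 un] := andP s1e.
  (* The added [1 / 2] makes truncation round [(s.1 + e) / d] to a nearest integer. *)
  pose u := (s.1 + e) / d + 1 / 2.
  have uE : s.1 + e = (u - 1 / 2) * d by rewrite /u addrK divfK ?gt_eqF.
  have u_ge0 : 0 <= u 
    by apply: addr_ge0; [apply: divr_ge0 => //; exact: ltW|lra].
  have /andP[ku uk] := truncn_itv u_ge0; exists (Num.truncn u).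
  split.
    rewrite -ltnS -(ltr_nat R); apply: le_lt_trans ku _.
    rewrite -natr1 /u ler_ltD//; last by lra.
    by rewrite ler_pdivrMr// nd.
  split=> //; split; first by rewrite /=; case: ifPn => //; rewrite -ltNge => /ltW.
  move: ku uk; rewrite /= uE -natr1; move: (Num.truncn u)%:R => k ku uk.
  have : k * d <= u * d by rewrite ler_pM2r.
  have : u * d <= (k + 1) * d by rewrite ler_pM2r// ltW.
  by move=> ? ?; apply/andP; split; lra.
have J_three s b0 k0 b1 k1 b2 k2 : J b0 k0 s -> J b1 k1 s -> J b2 k2 s ->
    (k0 <= n)%N -> (k1 <= n)%N -> (k2 <= n)%N ->
    [\/ (b0, k0) = (b1, k1), (b0, k0) = (b2, k2) | (b1, k1) = (b2, k2)].
  move=> [Ss [sb0 /andP[h0 h0']]] [_ [sb1 /andP[h1 h1']]] [_ [sb2 /andP[h2 h2']]].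
  move=> k0n k1n k2n.
  have near (x y : nat) : x%:R * d - y%:R * d <= d -> (x <= y.+1)%N.
    rewrite -mulrBl -[X in _ <= X]mul1r ler_pM2r// lerBlDr addrC natr1.
    by rewrite ler_nat.
  have far (x y : nat) : x%:R * d - y%:R * d <= d / 2 -> (x <= y)%N.
    rewrite -mulrBl mulrC ler_pM2l// lerBlDr => H.
    rewrite -ltnS -(ltr_nat R) -natr1; apply: le_lt_trans H _.
    by rewrite addrC ltrD2l; lra.
  have k01 : (k0 <= k1.+1)%N by apply: near; lra.
  have k10 : (k1 <= k0.+1)%N by apply: near; lra.
  have k02 : (k0 <= k2.+1)%N by apply: near; lra.
  have k20 : (k2 <= k0.+1)%N by apply: near; lra.
  have k12 : (k1 <= k2.+1)%N by apply: near; lra.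
  have k21 : (k2 <= k1.+1)%N by apply: near; lra.
  (* At the two corners on the axis the index is forced to be 0 or [n] and only the half varies.
     Elsewhere the half is forced, and the three indices are pairwise at distance at most 1. *)
  have [s20|s20] := eqVneq s.2 0.
    have kE : k0 = k1 /\ k1 = k2.
      move: Ss; rewrite /diamond /norm1 /= s20 normr0 addr0.
      case: (leP 0 s.1) => s10 => [|]; [rewrite ger0_norm// => se|].
        have ge (x : nat) : (x <= n)%N -> s.1 + e <= x%:R * d + d / 2 -> x = n.
          move=> xn H; apply/eqP; rewrite eqn_leq xn/=.
          by apply: far; rewrite nd; lra.
        by rewrite (ge k0)// (ge k1)// (ge k2).
      rewrite ltr0_norm// => se.
      have le (x : nat) : x%:R * d - d / 2 <= s.1 + e -> x = 0%N.
        move=> H; apply/eqP; rewrite -leqn0.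
        by apply: far; rewrite mul0r; lra.
      by rewrite (le k0)// (le k1)// (le k2).
    case: kE => -> ->.
    by case: {sb0} b0; case: {sb1} b1; case: {sb2} b2;
      first [exact: Or31|exact: Or32|exact: Or33].
  have bE b : (if b then 0 <= s.2 else s.2 <= 0) -> b = (0 < s.2).
    case: b => [|H]; first by rewrite le_eqVlt eq_sym (negPf s20).
    by apply/esym/negbTE; rewrite -leNgt.
  rewrite (bE _ sb0) (bE _ sb1) (bE _ sb2); clear -k01 k10 k02 k20 k12 k21.
  have [->|k01'] := eqVneq k0 k1; first exact: Or31.
  have [->|k02'] := eqVneq k0 k2; first exact: Or32.
  have [->|k12'] := eqVneq k1 k2; first exact: Or33.
  by exfalso; lia.
pose meets b k i := exists s, J b k s /\ C i s.
(* A piece that meets no colour gets 2 by default; this is harmless because [colP] is only applied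
   to pieces that meet some colour. *)
pose col b k : nat := if `[<meets b k 0%N>] then 0%N else
  if `[<meets b k 1%N>] then 1%N else 2%N.
have col3 b k : (col b k < 3)%N by rewrite /col; case: ifP => //; case: ifP.
have colP b k i : (i < 3)%N -> meets b k i -> meets b k (col b k).
  rewrite /col; case: asboolP => // n0i; case: asboolP => // n1i.
  by case: i => [|[|[|]]].
pose E i b := \bigcup_(k in [set k | (k <= n)%N /\ col b k = i]) J b k.
have clE i b : closed (E i b).
  apply: closed_bigcup => //; apply: (@sub_finite_set _ _ `I_n.+1).
    by move=> k [].
  exact: finite_II.
exists (fun i => C i `|` (E i true `|` E i false)); split.
- by move=> k k3; apply: closedU; [exact: clC|exact: closedU].
- by move=> k k3 s Cs; left.
- move=> s Ss; have [b [k [kn Js]]] := J_cover s Ss.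
  by exists (col b k) => //; right; case: b Js => Js; [left|right]; exists k.
move=> [s [D0 D1 D2]].
have DE i : (i < 3)%N -> (C i `|` (E i true `|` E i false)) s ->
    C i s \/ exists b k, [/\ (k <= n)%N, col b k = i & J b k s].
  move=> i3 [Cs|[[k [? ?] ?]|[k [? ?] ?]]]; [by left|by right; exists true, k|
    by right; exists false, k].
(* If [s] already has a colour, every piece at [s] meets a colour, hence its own, and the three
   colours come closer than [r]. If not, three differently coloured pieces meet at [s], against
   [J_three]. *)
have [[i i3 Cis]|nC] := pselect (exists2 i, (i < 3)%N & C i s).
  have close j : (j < 3)%N -> (C j `|` (E j true `|` E j false)) s ->
      exists2 t, C j t & `|s.1 - t.1| <= d /\ `|s.2 - t.2| <= d.
    move=> j3 /(DE j j3) [Cjs|[b [k [kn colj Js]]]].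
      by exists s; rewrite // !subrr normr0 ltW.
    have [|t [Jt Ct]] := @colP b k i i3; first by exists s.
    by exists t; [rewrite -colj|exact: J_small Js Jt].
  have [a Ca [sa sa']] := close 0%N isT D0.
  have [b Cb [sb sb']] := close 1%N isT D1.
  have [c Cc [sc sc']] := close 2%N isT D2.
  have tri (x y z : R) : `|x - y| <= d -> `|x - z| <= d -> `|y - z| < r.
    move=> xy xz; have -> : y - z = (y - x) + (x - z) by rewrite addrA subrK.
    apply: le_lt_trans (ler_normD _ _) _; rewrite distrC.
    by rewrite [r]splitr; apply: ltrD; apply: le_lt_trans nr.
  by apply: (rC a b c) => //; split; rewrite /ball /=; apply: tri; eassumption.
have [/= |[b0 [k0 [kn0 c0 J0]]]] := DE 0%N isT D0.
  by move=> ?; apply: nC; exists 0%N.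
have [/= |[b1 [k1 [kn1 c1 J1]]]] := DE 1%N isT D1.
  by move=> ?; apply: nC; exists 1%N.
have [/= |[b2 [k2 [kn2 c2 J2]]]] := DE 2%N isT D2.
  by move=> ?; apply: nC; exists 2%N.
have := J_three s _ _ _ _ _ _ J0 J1 J2 kn0 kn1 kn2.
case=> -[bE kE]; [move: c1|move: c2|move: c2].
- by rewrite -bE -kE c0.
- by rewrite -bE -kE c0.
- by rewrite -bE -kE c1.
Qed.
End Diamond.

(** * Injective images of the square are neighborhoods *)

Section Domain.
Variable R : realType.
Local Notation Q := (@square R).

Lemma norm1_gt0 (s : R * R) : s != 0 -> 0 < norm1 s.
Proof.
case: s => x y; rewrite /norm1 /= -[0]/((0, 0) : R * R) xpair_eqE negb_and.
case/orP => H; first by rewrite ltr_pwDl ?normr_gt0.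
by rewrite ltr_pwDr ?normr_gt0.
Qed.

(* If 0 is not in the image, the part of the square mapped into the ball of
   radius [e] can be recoloured by projecting radially to the diamond, whose
   colouring has no triple point. *)
Lemma square_image_center (f : R * R -> R * R) (e : R) :
  {within Q, continuous f} -> {in Q &, injective f} -> 0 < e ->
  norm1 (f 0) < e ->
  (forall p, Q p -> norm1 (f p) <= e -> `|p.1| < 1 /\ `|p.2| < 1) ->
  exists2 p, Q p & f p = 0.
Proof.
move=> cf injf e0 f0e fe; apply: contrapT => nE.
have Q0 : Q 0 by split => /=; rewrite lerN10 ler01.
have fN0 p : Q p -> f p != 0 by move=> Qp; apply/eqP => fp; apply: nE; exists p.
(* The sectors: the left half plane and the two right quadrants. *)
pose A (k : nat) : set (R * R) := match k with
  | 0%N => [set p | p.1 <= 0]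
  | 1%N => [set p | 0 <= p.1] `&` [set p | 0 <= p.2]
  | _ => [set p | 0 <= p.1] `&` [set p | p.2 <= 0] end.
have c1 : {for _, continuous (fst : R * R -> R)} by move=> s; exact: cvg_fst.
have c2 : {for _, continuous (snd : R * R -> R)} by move=> s; exact: cvg_snd.
have clA k : closed (A k).
  case: k => [|[|k]]; [|apply: closedI|apply: closedI].
  - exact: (preimage_closed (fun s _ => c1 s) (@closed_le R 0)).
  - exact: (preimage_closed (fun s _ => c1 s) (@closed_ge R 0)).
  - exact: (preimage_closed (fun s _ => c2 s) (@closed_ge R 0)).
  - exact: (preimage_closed (fun s _ => c1 s) (@closed_ge R 0)).
  - exact: (preimage_closed (fun s _ => c2 s) (@closed_le R 0)).
have A_cov p : exists2 k, (k < 3)%N & A k p.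
  have [p1|p1] := leP p.1 0; first by exists 0%N.
  have [p2|p2] := leP p.2 0; first by exists 2%N => //; split=> //; exact: ltW.
  by exists 1%N => //; split; exact: ltW.
have A_three p : A 0%N p -> A 1%N p -> A 2%N p -> p = 0.
  case: p => x y /= x0 [/= x0' y0] [/= _ y0'].
  by congr (_, _); apply/eqP; rewrite eq_le ?x0 ?x0' ?y0 ?y0'.
pose C k := f @` (Q `&` A k) `&` [set s | norm1 s = e].
have cC k : compact (C k).
  apply: compact_closedI; last exact: closed_diamond.
  apply: continuous_compact.
    by apply: continuous_subspaceW cf => ? [].
  by apply: compact_closedI; [exact: compact_square|exact: clA].
have clC k : closed (C k).
  by apply: compact_closed (cC k); exact: norm_hausdorff.
(* By injectivity a triple point on the diamond comes from a triple point of the sectors, that is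
   from 0, but [f 0] is strictly inside the diamond. *)
have C012 : ~ exists s, [/\ C 0%N s, C 1%N s & C 2%N s].
  move=> [s [[[p0 [Qp0 Ap0] fp0] _] [[p1 [Qp1 Ap1] fp1] _]
    [[p2 [Qp2 Ap2] fp2] se]]].
  have p01 : p0 = p1 by apply: injf; rewrite ?inE// fp0 fp1.
  have p02 : p0 = p2 by apply: injf; rewrite ?inE// fp0 fp2.
  move: Ap0 Ap1 Ap2; rewrite -p01 -p02 => Ap0 Ap1 Ap2.
  have p00 := A_three _ Ap0 Ap1 Ap2.
  by move: f0e; rewrite -p00 fp0 se ltxx.
have [D [clD CD covD triD]] := diamond_cover e0 (fun k _ => clC k) (cC 0%N)
  (fun k _ => @subIsetr _ _ _) C012.
pose proj (s : R * R) : R * R := (e / norm1 s * s.1, e / norm1 s * s.2).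
have proj_c s : s != 0 -> {for s, continuous proj}.
  move=> s0; have cN : e / norm1 x @[x --> s] --> e / norm1 s.
    apply: cvgM; first exact: cvg_cst.
    by apply: cvgV; [rewrite gt_eqF// norm1_gt0|exact: norm1_continuous].
  have := cvg_pair (cvgM cN (@cvg_fst _ _ (nbhs s.1) (nbhs s.2) _))
                   (cvgM cN (@cvg_snd _ _ (nbhs s.1) (nbhs s.2) _)).
  exact.
have norm_proj s : s != 0 -> norm1 (proj s) = e.
  move=> /norm1_gt0 s0; have k0 : 0 < e / norm1 s by rewrite divr_gt0.
  rewrite -[RHS](divfK (lt0r_neq0 s0)) /proj; move: (e / norm1 s) k0 => k k0.
  by rewrite /norm1 /= !normrM gtr0_norm// -mulrDr.
have proj_id s : norm1 s = e -> proj s = s.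
  by rewrite /proj => ->; rewrite divff ?gt_eqF// !mul1r; case: s.
(* Outside the diamond the sectors are kept; inside, the colours [D k] are pulled back along
   [proj \o f], which is defined because [f] avoids 0. *)
pose F k := (Q `&` (@norm1 R \o f) @^-1` [set x | e <= x] `&` A k) `|`
  ((Q `&` (@norm1 R \o f) @^-1` [set x | x <= e]) `&`
   (Q `&` (proj \o f) @^-1` D k)).
have cNf : {within Q, continuous (@norm1 R \o f)}.
  by apply: within_continuous_post cf _ => x _; exact: norm1_continuous.
have cPf : {within Q, continuous (proj \o f)}.
  by apply: within_continuous_post cf _ => x Qx; exact: proj_c (fN0 x Qx).
have clF k : (k < 3)%N -> closed (F k).
  move=> k3; apply: closedU; apply: closedI.
  - exact: (closed_within_preimage (@closed_square R) cNf (@closed_ge R e)).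
  - exact: clA.
  - exact: (closed_within_preimage (@closed_square R) cNf (@closed_le R e)).
  - exact: (closed_within_preimage (@closed_square R) cPf (clD k k3)).
(* On the diamond itself the two definitions are compatible, because [C k] is contained in [D k] and
   [proj] is the identity there. *)
have FP k p : (k < 3)%N -> F k p -> [/\ (e < norm1 (f p) -> A k p) &
    (norm1 (f p) <= e -> D k (proj (f p)))].
  move=> k3 [[[Qp /= fpe] Ap]|[[Qp /= fpe] [_ Dp]]]; split => //.
    move=> fpe'; have fpE : norm1 (f p) = e by apply/eqP; rewrite eq_le fpe'.
    by apply: CD => //; split; rewrite /= proj_id//; exists p.
  by move=> H; have := lt_le_trans H fpe; rewrite ltxx.
(* The boundary of the square is mapped outside the diamond, so the recolouring does not disturb the
   side conditions of [square_cover]. *)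
have bdry k p : (k < 3)%N -> Q p -> F k p -> 1 <= `|p.1| \/ 1 <= `|p.2| -> A k p.
  move=> k3 Qp /(FP _ _ k3)[+ _] p1; apply.
  rewrite ltNge; apply/negP => /(fe p Qp)[p1' p2'].
  by case: p1 => p1; [move: p1'|move: p2']; rewrite ltNge p1.
have [||||||||p [Qp F0 F1 F2]] := @square_cover R (F 0%N) (F 1%N) (F 2%N).
- exact: clF.
- exact: clF.
- exact: clF.
- move=> p Qp; have [fpe|fpe] := leP e (norm1 (f p)).
    have [[|[|[|//]]] _ Ap] := A_cov p; [left; left|left; right|right]; by left.
  have [[|[|[|//]]] _ Dp] := covD _ (norm_proj _ (fN0 _ Qp));
    [left; left|left; right|right]; right; split; rewrite //=; split => //; exact: ltW.
- move=> p Qp p1; have N1 : 1 <= `|p.1| by rewrite p1 normrN1.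
  by split=> /bdry -/(_ isT Qp (or_introl N1)) [/= + _]; rewrite p1 ler0N1.
- move=> p Qp p2 /bdry; have N1 : 1 <= `|p.2| by rewrite p2 normrN1.
  by move=> /(_ isT Qp (or_intror N1)) [/= _]; rewrite p2 ler0N1.
- move=> p Qp p2 /bdry; have N1 : 1 <= `|p.2| by rewrite p2 normr1.
  by move=> /(_ isT Qp (or_intror N1)) [/= _]; rewrite p2 ler10.
- move=> p Qp p1 /bdry; have N1 : 1 <= `|p.1| by rewrite p1 normr1.
  by move=> /(_ isT Qp (or_introl N1)) /=; rewrite p1 ler10.
have [G0 H0] := FP 0%N p isT F0; have [G1 H1] := FP 1%N p isT F1.
have [G2 H2] := FP 2%N p isT F2.
have [fpe|fpe] := leP (norm1 (f p)) e.
  by apply: triD; exists (proj (f p)); split; auto.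
have p0 : p = 0 by apply: A_three; auto.
by move: f0e; rewrite -p0 ltNge ltW.
Qed.

(** The image of the boundary of the square is compact and stays outside the ball of some radius [r]
    around [f 0]. For [c] within [r / 4] of [f 0], the map [f - c] satisfies the previous lemma with
    [e = r / 2], so [c] is attained. *)
Lemma square_image_nbhs (f : R * R -> R * R) :
  {within Q, continuous f} -> {in Q &, injective f} -> nbhs (f 0) (f @` Q).
Proof.
move=> cf injf.
have Q0 : Q 0 by split => /=; rewrite lerN10 ler01.
pose S := Q `&` [set p : R * R | 1 <= Num.max `|p.1| `|p.2|].
have clS : closed (f @` S).
  apply: compact_closed; first exact: norm_hausdorff.
  apply: continuous_compact; first by apply: continuous_subspaceW cf => ? [].
  apply: compact_closedI; first exact: compact_square.
  have cm : continuous (fun p : R * R => Num.max `|p.1| `|p.2|).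
    by move=> p; apply: (@norm_continuous _ (R * R)%type).
  exact: (preimage_closed (fun s _ => cm s) (@closed_ge R 1)).
have fS : ~ (f @` S) (f 0).
  move=> [p [Qp Sp] /injf E]; move: Sp; rewrite E ?inE//= normr0 maxxx.
  by rewrite leNgt ltr01.
have : nbhs (f 0) (~` (f @` S)).
  by apply: open_nbhs_nbhs; split=> //; exact: closed_openC.
move=> /nbhs_ballP[r /= r0 rS].
apply/nbhs_ballP; exists (r / 4) => /=; first by rewrite divr_gt0.
move=> c [/= c1 c2]; have [|||||p Qp] := @square_image_center (f - cst c) (r / 2).
- by move=> p; apply: cvgB; [exact: cf|exact: cvg_cst].
- by move=> p p' Qp Qp' /addIr /injf; exact.
- by rewrite divr_gt0.
- by move: c1 c2; rewrite /ball /= /norm1 /= => c1 c2; lra.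
- move=> p Qp; rewrite /norm1 /= => H.
  have : ~ S p.
    move=> Sp; apply: (rS (f p)); last by exists p.
    move: c1 c2 H; rewrite /ball /= => c1 c2 H.
    have D (x y z : R) : `|x - y| < r / 4 -> `|z - y| <= r / 2 -> `|x - z| < r.
      by rewrite !ltr_norml ler_norml => /andP[? ?] /andP[? ?];
        apply/andP; split; lra.
    split; [apply: D c1 _|apply: D c2 _]; apply: le_trans H.
      by rewrite lerDl.
    by rewrite lerDr.
  move=> /not_andP[//|/negP]; rewrite -ltNge gt_max => /andP[]; by split.
by move=> /eqP; rewrite subr_eq0 => /eqP fc; exists p.
Qed.

(** [F] is not asked to have an open image in [T]: at a singular circle the disc lies in one piece
    while other sheets pass through [z]. *)
Definition disc_at (T : topologicalType) (P : set T) (z : T) :=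
  exists F : R * R -> T, [/\ {within Q, continuous F},
    {in Q &, injective F}, F 0 = z & forall p, Q p -> P (F p)].

Lemma invariance_of_domain (T : topologicalType) (P : set T) (z : T)
    (g : T -> R * R) :
  disc_at P z -> {within P, continuous g} -> {in P &, injective g} ->
  nbhs (g z) (g @` P).
Proof.
move=> [F [cF injF <- FP]] cg injg.
have := @square_image_nbhs (g \o F) (within_continuous_comp FP cF cg).
have inj : {in Q &, injective (g \o F)}.
  move=> p p' Qp Qp' /injg E; apply: injF => //.
  by apply: E; rewrite inE; apply: FP; rewrite -inE.
by move=> /(_ inj); apply: filterS => _ [p Qp <-]; exists (F p) => //; exact: FP.
Qed.

End Domain.

(** * Surfaces and their boundary *)

Section Prelim.

Lemma within_nbhs (T U : topologicalType) (A : set T) (f : T -> U) x W :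
  {within A, continuous f} -> A x -> nbhs (f x) W ->
  nbhs x (fun y => A y -> W (f y)).
Proof. by move=> /subspace_continuousP cf Ax; exact: cf. Qed.

Lemma within_continuous_pair (T U V : topologicalType) (A : set T)
    (f : T -> U) (g : T -> V) :
  {within A, continuous f} -> {within A, continuous g} ->
  {within A, continuous (fun x => (f x, g x))}.
Proof.
move=> /subspace_continuousP cf /subspace_continuousP cg.
by apply/subspace_continuousP => x Ax; apply: cvg_pair; [exact: cf|exact: cg].
Qed.

Lemma within_continuous_eq (T U : topologicalType) (A : set T) (f g : T -> U) :
  (forall x, A x -> f x = g x) -> {within A, continuous f} ->
  {within A, continuous g}.
Proof.
by move=> fg; apply: subspace_eq_continuous => x; rewrite inE; exact: fg.
Qed.

Lemma open_mem_nbhs (T : topologicalType) (A : set T) x :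
  open A -> A x -> nbhs x A.
Proof. by move=> oA Ax; apply: open_nbhs_nbhs. Qed.

(** Converts the openness clause into a continuous inverse; [x0] is the junk value outside [V]. *)
Lemma homeo_onto_inverse (A B : topologicalType) (U : set A) (g : A -> B)
    (V : set B) (x0 : A) :
  homeo_onto U g V -> exists k : B -> A,
    [/\ forall v, V v -> U (k v) /\ g (k v) = v,
        forall u, U u -> k (g u) = u & {within V, continuous k}].
Proof.
move=> [injg gU cg gop].
pose k v := xget x0 [set u | U u /\ g u = v].
have kV v : V v -> U (k v) /\ g (k v) = v.
  rewrite -gU => -[u Uu <-].
  by apply: (@xgetPex _ x0 [set u' | U u' /\ g u' = g u]); exists u.
have VU u : U u -> V (g u) by rewrite -gU => Uu; exists u.
have kg u : U u -> k (g u) = u.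
  move=> Uu; have [Uk gk] := kV _ (VU u Uu).
  by apply: injg => //; rewrite inE.
exists k; split=> //; apply/subspace_continuousP => v Vv W.
rewrite nbhsE => -[G [Go Gk] GW].
have [W' [Wo' E]] := gop G Go.
have [Uk gk] := kV v Vv.
have W'v : W' v.
  suff : (W' `&` V) v by case.
  by rewrite -E; exists (k v).
apply: filterS (open_mem_nbhs Wo' W'v) => y W'y Vy.
have : (W' `&` V) y by [].
rewrite -E => -[u [Gu Uu] <-]; suff : W (k (g u)) by [].
by rewrite kg//; exact: GW.
Qed.

End Prelim.

Section Charts.
Variable R : realType.
Implicit Types (T : topologicalType) (a p : R * R).
Local Notation Q := (@square R).

Definition dilate a (r : R) p : R * R := (a.1 + r * p.1, a.2 + r * p.2).

Lemma dilate_continuous a r : continuous (dilate a r).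
Proof.
move=> p; apply: (@cvg_pair _ _ _ _ (nbhs _) (nbhs _)).
  by apply: cvgD; [exact: cvg_cst|apply: cvgM; [exact: cvg_cst|exact: cvg_fst]].
by apply: cvgD; [exact: cvg_cst|apply: cvgM; [exact: cvg_cst|exact: cvg_snd]].
Qed.

Lemma dilate_inj a r : r != 0 -> injective (dilate a r).
Proof.
by move=> r0 [x y] [x' y'] [] /addrI /(mulfI r0) -> /addrI /(mulfI r0) ->.
Qed.

Lemma dilate0 a r : dilate a r 0 = a.
Proof. by case: a => x y; rewrite /dilate /= !mulr0 !addr0. Qed.

Lemma nbhs_dilate a (W : set (R * R)) : nbhs a W ->
  exists2 r, 0 < r & forall p, Q p -> W (dilate a r p).
Proof.
move=> /nbhs_ballP[e /= e0 eW]; exists (e / 2); first by rewrite divr_gt0.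
move=> [x y] [/= /andP[x1 x2] /andP[y1 y2]]; apply: eW.
have small u z : -1 <= z -> z <= 1 -> `|u - (u + e / 2 * z)| < e.
  move=> z1 z2; rewrite opprD addrA subrr add0r normrN normrM.
  rewrite gtr0_norm ?divr_gt0//.
  have zl : `|z| <= 1 by rewrite ler_norml z1.
  apply: le_lt_trans (_ : e / 2 * 1 < e); last by lra.
  by rewrite ler_pM2l// divr_gt0.
by split; exact: small.
Qed.

(** Any small square around [a] reaches below the axis. Applied to images of discs, this contradicts
    invariance of domain. *)
Lemma not_nbhs_halfplane a (W : set (R * R)) :
  a.2 = 0 -> W `<=` @halfplane R -> ~ nbhs a W.
Proof.
move=> a2 WH /nbhs_dilate[r r0 /(_ (0, -1))].
have Qp : Q (0, -1) by split => /=; lra.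
by move=> /(_ Qp) /WH; rewrite /halfplane /= a2; lra.
Qed.

Lemma disc_at_mono T (P P' : set T) z : P `<=` P' -> disc_at R P z ->
  disc_at R P' z.
Proof. by move=> PP' [F [? ? ? FP]]; exists F; split => // p /FP /PP'. Qed.

Lemma disc_at_image T (T' : topologicalType) (P : set T) z (g : T -> T') :
  {within P, continuous g} -> {in P &, injective g} -> disc_at R P z ->
  disc_at R (g @` P) (g z).
Proof.
move=> cg injg [F [cF injF <- FP]]; exists (g \o F); split => //.
- exact: within_continuous_comp FP cF cg.
- move=> p p' Qp Qp' /= E; apply: injF => //; apply: injg => //;
  by rewrite inE; apply: FP; rewrite -inE.
- by move=> p Qp; exists (F p) => //; exact: FP.
Qed.

Lemma interior_disc T (U : set T) (g : T -> R * R) x O :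
  surface_chart U g -> U x -> 0 < (g x).2 -> nbhs x O -> disc_at R O x.
Proof.
move=> [Uo [W [Wo hg]]] Ux gx0 Ox.
have [k [kV kg ck]] := homeo_onto_inverse x hg.
have [_ gU _ _] := hg.
have [Wgx _] : (W `&` @halfplane R) (g x) by rewrite -gU; exists x.
have : nbhs (g x) (W `&` [set p | 0 < p.2] `&`
    (fun y => (W `&` @halfplane R) y -> O (k y))).
  apply: filterI; first apply: filterI.
  - exact: open_mem_nbhs.
  - apply: open_mem_nbhs => //.
    have c2 : {for _, continuous (snd : R * R -> R)} by move=> s; exact: cvg_snd.
    exact: (open_comp (fun s _ => c2 s) (@open_gt R 0)).
  - by apply: within_nbhs ck _ _; [split => //; exact: ltW|rewrite kg].
move=> /nbhs_dilate[r r0 rP].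
have QV p : Q p -> (W `&` @halfplane R) (dilate (g x) r p).
  by move=> /rP[[? ?] _]; split => //; exact: ltW.
exists (k \o dilate (g x) r); split.
- apply: within_continuous_comp QV _ ck.
  by apply: continuous_subspaceT; exact: dilate_continuous.
- move=> p p'; rewrite !inE => Qp Qp' /= E; apply: (@dilate_inj (g x) r).
    by rewrite gt_eqF.
  by rewrite -(kV _ (QV p Qp)).2 -(kV _ (QV p' Qp')).2 E.
- by rewrite /= dilate0 kg.
- by move=> p Qp; apply: (rP p Qp).2; exact: QV.
Qed.

(** Invariance of the boundary: a disc around [x], read in a boundary chart, would be a neighborhood
    of a point of the axis inside the half plane. *)
Lemma interior_not_sbdry T (U : set T) (g : T -> R * R) x :
  surface_chart U g -> U x -> 0 < (g x).2 -> ~ sbdry R x.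
Proof.
move=> cg Ux gx0 [U' [g' [U'x cg' g'x0]]].
have Ox : nbhs x (U `&` U').
  apply: filterI; apply: open_mem_nbhs => //; [exact: cg.1|exact: cg'.1].
have D := interior_disc cg Ux gx0 Ox.
have [_ [W [_ [injg' gU cg'' _]]]] := cg'.
apply: (@not_nbhs_halfplane (g' x) (g' @` (U `&` U')) g'x0).
  move=> _ [y [_ U'y] <-].
  by have [] : (W `&` @halfplane R) (g' y) by rewrite -gU; exists y.
apply: invariance_of_domain D _ _.
  by apply: continuous_subspaceW cg'' => ? [].
by move=> y y'; rewrite !inE => -[_ Uy] [_ Uy']; apply: injg'; rewrite inE.
Qed.
End Charts.

(** * Half discs at boundary points *)

Section HalfDisc.
Variable R : realType.
Implicit Types (T : topologicalType) (p : R * R).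
Local Notation Q := (@square R).

Lemma surface_chart_ge0 T (U : set T) (g : T -> R * R) x :
  surface_chart U g -> U x -> 0 <= (g x).2.
Proof.
move=> [_ [W [_ [_ gU _ _]]]] Ux.
by have [] : (W `&` @halfplane R) (g x) by rewrite -gU; exists x.
Qed.

Lemma surface_chart_inj T (U : set T) (g : T -> R * R) x y :
  surface_chart U g -> U x -> U y -> g x = g y -> x = y.
Proof. by move=> [_ [W [_ [injg _ _ _]]]] Ux Uy; apply: injg; rewrite inE. Qed.

Lemma surface_chart_continuous T (U : set T) (g : T -> R * R) :
  surface_chart U g -> {within U, continuous g}.
Proof. by move=> [_ [W [_ [_ _ cg _]]]]. Qed.

Lemma surface_chart_sbdry T (U : set T) (g : T -> R * R) x :
  surface_chart U g -> U x -> sbdry R x -> (g x).2 = 0.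
Proof.
move=> cg Ux bx; apply/eqP; rewrite eq_le (surface_chart_ge0 cg Ux) andbT.
by rewrite leNgt; apply/negP => /(interior_not_sbdry cg Ux).
Qed.

Definition half_box (r : R) : set (R * R) :=
  [set p | -r <= p.1 <= r /\ 0 <= p.2 <= r].

(** A normal form for gluing: [K] inverts the chart up to a translation along the axis, so boundary
    points of the surface correspond to [p.2 = 0]. *)
Lemma half_box_chart T (U : set T) (g : T -> R * R) x G :
  surface_chart U g -> U x -> (g x).2 = 0 -> nbhs x G ->
  exists K r, [/\ 0 < r, {within half_box r, continuous K}, K 0 = x &
    forall p, half_box r p ->
      [/\ U (K p), G (K p) & g (K p) = ((g x).1 + p.1, p.2)]].
Proof.
move=> [Uo [W [Wo hg]]] Ux gx0 Gx.
have [k [kV kg ck]] := homeo_onto_inverse x hg.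
have [_ gU _ _] := hg.
have Vgx : (W `&` @halfplane R) (g x) by rewrite -gU; exists x.
have : nbhs (g x) (W `&` (fun y => (W `&` @halfplane R) y -> G (k y))).
  apply: filterI; first exact: open_mem_nbhs Vgx.1.
  by apply: within_nbhs ck Vgx _; rewrite kg.
move=> /nbhs_dilate[r r0 rP].
pose sh p : R * R := ((g x).1 + p.1, p.2).
have shP p : half_box r p -> (W `&` @halfplane R) (sh p) /\ G (k (sh p)).
  move=> [/andP[p1 p2] /andP[p3 p4]].
  have Qp : Q (p.1 / r, p.2 / r).
    by split; rewrite /= ler_pdivlMr// ler_pdivrMr// ?mulN1r mul1r;
      apply/andP; split => //; lra.
  have E : dilate (g x) r (p.1 / r, p.2 / r) = sh p.
    by rewrite /dilate /sh /= gx0 add0r ![r * _]mulrC !divfK// gt_eqF.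
  have := rP _ Qp; rewrite E => -[Wp Gp].
  by have Vp : (W `&` @halfplane R) (sh p); [split|split => //; exact: Gp].
have csh : continuous sh.
  move=> p; apply: (@cvg_pair _ _ _ _ (nbhs _) (nbhs _)); last exact: cvg_snd.
  by apply: cvgD; [exact: cvg_cst|exact: cvg_fst].
exists (k \o sh), r; split => //.
- apply: within_continuous_comp (fun p bp => (shP p bp).1) _ ck.
  exact: continuous_subspaceT csh.
- rewrite /= /sh /= addr0 -[RHS]kg//; congr k.
  by rewrite -gx0; case: (g x).
- move=> p bp; have [Vp Gp] := shP p bp; have [Uk gk] := kV _ Vp.
  by split.
Qed.

Lemma sbdry_approx T (x : T) (G : set T) :
  @surface_with_boundary R T -> nbhs x G -> exists2 y, G y & ~ sbdry R y.
Proof.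
move=> sT Gx; have [U [g [Ux cg]]] := sT x.
have [bx|] := pselect (sbdry R x); last by exists x => //; exact: nbhs_singleton.
have gx0 := surface_chart_sbdry cg Ux bx.
have [K [r [r0 _ _ KP]]] := half_box_chart cg Ux gx0 Gx.
(* Pushing [x] straight up from the boundary line gives an interior point. *)
have [|UK GK gK] := KP (0, r); first by split => /=; lra.
exists (K (0, r)) => //; apply: (interior_not_sbdry cg UK).
by rewrite gK.
Qed.

Lemma interior_chart T (x : T) (G : set T) :
  @surface_with_boundary R T -> nbhs x G -> ~ sbdry R x -> exists U (g : T -> R * R),
    [/\ open U /\ U x, U `<=` G `\` @sbdry R T,
        {within U, continuous g}, {in U &, injective g} &
        forall y (G' : set T), U y -> nbhs y G' -> disc_at R G' y].
Proof.
move=> sT Gx nbx; have [U [g [Ux cg]]] := sT x.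
have gx0 : 0 < (g x).2.
  rewrite lt_neqAle (surface_chart_ge0 cg Ux) andbT eq_sym; apply/eqP => gx0.
  by apply: nbx; exists U, g.
pose U' := U `&` [set y | 0 < (g y).2].
have Uo' : open U'.
  rewrite openE => y [Uy gy].
  have c2 : {for _, continuous (snd : R * R -> R)} by move=> s; exact: cvg_snd.
  have H : nbhs (g y) (snd @^-1` [set x | 0 < x]).
    by apply: open_mem_nbhs => //; exact: (open_comp (fun s _ => c2 s) (@open_gt R 0)).
  have Uny : nbhs y U by apply: open_mem_nbhs Uy; exact: cg.1.
  have := within_nbhs (surface_chart_continuous cg) Uy H.
  by move=> /(filterI Uny); apply: filterS => z [Uz /(_ Uz)].
exists (U' `&` G^°), g; split => //.
- split; first by apply: openI => //; exact: open_interior.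
  by split.
- move=> y [[Uy gy] /interior_subset Gy]; split => //.
  exact: interior_not_sbdry cg Uy gy.
- by apply: continuous_subspaceW (surface_chart_continuous cg) => ? [[]].
- move=> y z; rewrite !inE => -[[Uy _] _] [[Uz _] _].
  exact: surface_chart_inj cg Uy Uz.
- move=> y G' [[Uy gy] _]; exact: interior_disc cg Uy gy.
Qed.

End HalfDisc.

(** * Gluing two half discs along a singular circle *)

Section Glue.
Variable R : realType.
Local Notation Q := (@square R).

(* Two half discs of the surface at points [x != y] with the same attaching
   value fit together along their diameters: the coordinate [tau] of the lower
   half disc is the lift through [y] of the diameter of the upper one. *)
Lemma glued_disc (T X : topologicalType) (I : Type) (phi : T -> I * (R * R))
    (q : T -> X) (x y : T) (G : set X) :
  @surface_with_boundary R T -> hausdorff_space T -> continuous q ->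
  (forall u v, sbdry R u -> sbdry R v -> phi u = phi v -> q u = q v) ->
  (forall u v, q u = q v -> u = v \/ [/\ sbdry R u, sbdry R v & phi u = phi v]) ->
  sbdry R x ->
  (forall z, connected_component (@sbdry R T) x z -> (phi z).1 = (phi x).1) ->
  covering_map (connected_component (@sbdry R T) x) (fun z => (phi z).2) (@S1 R) ->
  connected_component (@sbdry R T) x y -> y <> x -> phi y = phi x ->
  nbhs (q x) G -> disc_at R (G `&` range q) (q x).
Proof.
move=> sT hT cq q_eq eq_q bx; set B := connected_component _ x => phi1 cov By yx.
move=> phiyx Gx; pose pr z := (phi z).2.
have Bx : B x by exact: connected_component_refl.
have Bb : B `<=` @sbdry R T by exact: connected_component_sub.
have [prB cpr] := cov; have S1x : S1 (pr x) by rewrite -prB; exists x.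
move=> /(_ _ S1x)[V [_ Vx [F [FP _ FE]]]].
have [Ux FUx Uxx] : (\bigcup_(U in F) U) x by rewrite -FE.
have [Uy FUy Uyy] : (\bigcup_(U in F) U) y.
  by rewrite -FE; split => //; rewrite /= phiyx.
have [[Wx [Wxo UxE]] [injx Vpx _ _]] := FP _ FUx.
have [[Wy [Wyo UyE]] hy] := FP _ FUy.
(* [k] lifts points of the evenly covered set [V] to the sheet through [y]. *)
have [k [kV ky ck]] := homeo_onto_inverse y hy.
(* Disjoint neighborhoods keep the two half discs apart in the surface, so that they meet only
   through the attaching map. *)
have := hT; rewrite open_hausdorff => /(_ x y).
have -> : x != y by apply/eqP => E; exact: yx.
move=> /(_ isT)[[Nx Ny] /= [+ +] [Nxo Nyo /eqP Nxy]].
rewrite !inE => Nxx Nyy.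
have [U [g [Uux cg]]] := sT x; have [U' [g' [Uy' cg']]] := sT y.
have gx0 := surface_chart_sbdry cg Uux bx.
have gy0 := surface_chart_sbdry cg' Uy' (Bb _ By).
have nx : nbhs x (Nx `&` Wx `&` q @^-1` G).
  apply: filterI; last exact: cq.
  apply: filterI; apply: open_mem_nbhs => //.
  by move: Uxx; rewrite UxE => -[].
have qyx : q y = q x by apply: q_eq => //; exact: Bb.
have ny : nbhs y (Ny `&` q @^-1` G).
  by apply: filterI; [exact: open_mem_nbhs|apply: cq; rewrite qyx].
have [K [r [r0 cK K0 KP]]] := half_box_chart cg Uux gx0 nx.
have [K' [r' [r'0 cK' K'0 KP']]] := half_box_chart cg' Uy' gy0 ny.
pose seg (e : R) := `[-e, e]%classic.
have segP e t : seg e t -> -e <= t <= e by rewrite /seg /= in_itv.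
pose L t := K (t, 0).
have seg_box t : seg r t -> half_box r (t, 0).
  by move=> /segP tr; split => //=; rewrite lexx ltW.
have cL : {within seg r, continuous L}.
  apply: within_continuous_comp seg_box _ cK.
  apply: continuous_subspaceT => t;
    apply: (@cvg_pair _ _ _ _ (nbhs _) (nbhs _)); [exact: cvg_id|exact: cvg_cst].
have Lb t : seg r t -> sbdry R (L t).
  by move=> /seg_box/KP[UK _ gK]; exists U, g; split => //; rewrite gK.
have seg0 e : 0 < e -> seg e 0 by move=> e0; rewrite /seg /= in_itv /=; lra.
(* The diameter is connected and contains [x], so it stays in the boundary component where the
   covering is defined. *)
have LB t : seg r t -> B (L t).
  move=> tr; apply: (@connected_component_max _ _ (L @` seg r) x); last by exists t.
  - by exists 0 => //; exact: seg0.
  - by move=> _ [u /Lb ? <-].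
  - apply: connected_continuous_connected cL; exact: segment_connected.
have LU t : seg r t -> Ux (L t).
  move=> tr; rewrite UxE; split; last exact: LB.
  by have [_ [[_ ?] _] _] := KP _ (seg_box t tr).
have prLV t : seg r t -> V (pr (L t)).
  by move=> /LU ULt; rewrite -Vpx; exists (L t).
pose b t := k (pr (L t)).
have cb : {within seg r, continuous b}.
  apply: within_continuous_comp prLV _ ck.
  exact: within_continuous_comp LB cL cpr.
have bP t : seg r t -> Uy (b t) /\ pr (b t) = pr (L t) by move=> /prLV/kV.
have bB t : seg r t -> B (b t) by move=> /bP[]; rewrite UyE => -[].
have b0 : b 0 = y by rewrite /b /L K0 -[RHS]ky// /pr phiyx.
(* The diameter is shortened until its lift stays in the chart at [y] and within the width of the
   lower half box. *)
have [r1 [r10 r1r r1P]] : exists r1, [/\ 0 < r1, r1 <= r & forall t, seg r1 t ->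
    U' (b t) /\ -r' <= (g' (b t)).1 - (g' y).1 <= r'].
  have gn : nbhs (g' y) (fun s => `|(g' y).1 - s.1| < r').
    by apply/nbhs_ballP; exists r' => //= s [].
  have := within_nbhs (surface_chart_continuous cg') Uy' gn.
  have U'y : nbhs y U' by apply: open_mem_nbhs Uy'; exact: cg'.1.
  move=> /(filterI U'y); rewrite -[X in nbhs X _]b0.
  move=> /(within_nbhs cb (seg0 r r0)) /nbhs_ballP[e /= e0 eP].
  have [r1 [r10 r1r r1e]] : exists r1, [/\ 0 < r1, r1 <= r & r1 <= e / 2].
    exists (Num.min r (e / 2)).
    by rewrite lt_min r0 divr_gt0// !ge_min !lexx orbT.
  exists r1; split => // t /segP/andP[t1 t2].
  have [||U'b /(_ U'b)] := eP t.
  - by rewrite /ball /= sub0r normrN ltr_norml; apply/andP; split; lra.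
  - by rewrite /seg /= in_itv /=; apply/andP; split; lra.
  - by rewrite ltr_norml => /andP[? ?]; split => //; apply/andP; split; lra.
have segS t : seg r1 t -> seg r t.
  by rewrite /seg /= !in_itv /= => /andP[? ?]; apply/andP; split; lra.
pose tau t := (g' (b t)).1 - (g' y).1.
have ctau : {within seg r1, continuous tau}.
  have cgb : {within seg r1, continuous (g' \o b)}.
    apply: within_continuous_comp (fun t tr => (r1P t tr).1) _ _.
      exact: continuous_subspaceW segS cb.
    exact: surface_chart_continuous cg'.
  have H := within_continuous_post cgb (g := fun s : R * R => s.1 - (g' y).1).
  apply: H => s _; apply: cvgB; [exact: cvg_fst|exact: cvg_cst].
have gb0 t : seg r1 t -> (g' (b t)).2 = 0.
  move=> tr; apply: surface_chart_sbdry cg' (r1P t tr).1 _.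
  by apply/Bb/bB/segS.
(* Equal coordinates give equal lifts, hence equal attaching values of [L t] and [L t'], which lie
   in one sheet. *)
have tau_inj t t' : seg r1 t -> seg r1 t' -> tau t = tau t' -> t = t'.
  move=> tr tr' /addIr E.
  have Eb : b t = b t'.
    apply: surface_chart_inj cg' (r1P t tr).1 (r1P t' tr').1 _.
    move: E (gb0 t tr) (gb0 t' tr').
    by case: (g' (b t)) => ? ?; case: (g' (b t')) => ? ? /= -> -> ->.
  have [tS tS'] := (segS t tr, segS t' tr').
  have EL : L t = L t'.
    apply: injx; rewrite ?inE; [exact: LU|exact: LU|].
    exact: etrans (esym (bP t tS).2) (etrans (congr1 pr Eb) (bP t' tS').2).
  have [_ _ gK] := KP _ (seg_box t tS); have [_ _ gK'] := KP _ (seg_box t' tS').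
  by move: gK; rewrite -/(L t) EL gK' => -[/addrI].
have tau_box t v : seg r1 t -> 0 <= v <= r' -> half_box r' (tau t, v).
  by move=> /r1P[].
have K'tau t : seg r1 t -> K' (tau t, 0) = b t.
  move=> tr; have [|U'K _ g'K] := KP' _ (tau_box t 0 tr _).
    by rewrite lexx ltW.
  apply: surface_chart_inj cg' U'K (r1P t tr).1 _; rewrite g'K /tau /=.
  by rewrite addrC subrK -(gb0 t tr); case: (g' _).
pose up p := K (r1 * p.1, r * p.2).
pose dn p := K' (tau (r1 * p.1), r' * - p.2).
have segM (p : R * R) : Q p -> seg r1 (r1 * p.1).
  move=> [/andP[? ?] _]; rewrite /seg /= in_itv /=.
  by apply/andP; split; nra.
have up_box p : Q p -> 0 <= p.2 -> half_box r (r1 * p.1, r * p.2).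
  move=> Qp p20; split => /=; first by apply/segP/segS/segM.
  by have [_ /andP[_ ?]] := Qp; rewrite mulr_ge0 ?ler_piMr// ltW.
have dn_box p : Q p -> p.2 <= 0 -> half_box r' (tau (r1 * p.1), r' * - p.2).
  move=> Qp p20; apply: tau_box; first exact: segM.
  have [_ /andP[? _]] := Qp; rewrite mulr_ge0 ?oppr_ge0 ?(ltW r'0)//.
  by rewrite ler_piMr ?(ltW r'0)// lerNl.
pose f p := if 0 <= p.2 then q (up p) else q (dn p).
pose Qu := Q `&` [set p | 0 <= p.2]; pose Qd := Q `&` [set p | p.2 <= 0].
have c2 : {for _, continuous (snd : R * R -> R)} by move=> s; exact: cvg_snd.
have clu : closed Qu.
  apply: closedI; first exact: closed_square.
  exact: (preimage_closed (fun s _ => c2 s) (@closed_ge R 0)).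
have cld : closed Qd.
  apply: closedI; first exact: closed_square.
  exact: (preimage_closed (fun s _ => c2 s) (@closed_le R 0)).
have QE : Q = Qu `|` Qd.
  apply/seteqP; split => [p Qp|p [[]//|[]//]].
  by have [?|/ltW ?] := leP 0 p.2; [left|right].
have cqu : {within Qu, continuous (q \o up)}.
  apply: within_continuous_post; last by move=> ? _; exact: cq.
  apply: (within_continuous_comp (B := half_box r) (g := K)) => //.
    by move=> p [Qp p2]; exact: up_box.
  apply: continuous_subspaceT => p; apply: (@cvg_pair _ _ _ _ (nbhs _) (nbhs _)).
    by apply: cvgM; [exact: cvg_cst|exact: cvg_fst].
  by apply: cvgM; [exact: cvg_cst|exact: cvg_snd].
have cqd : {within Qd, continuous (q \o dn)}.
  apply: within_continuous_post; last by move=> ? _; exact: cq.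
  apply: (within_continuous_comp (B := half_box r') (g := K')) => //.
    by move=> p [Qp p2]; exact: dn_box.
  apply: within_continuous_pair.
    apply: (within_continuous_comp (B := seg r1) (g := tau)) => //.
      by move=> p [Qp _]; exact: segM.
    by apply: continuous_subspaceT => p; apply: cvgM; [exact: cvg_cst|exact: cvg_fst].
  apply: continuous_subspaceT => p; apply: cvgM; first exact: cvg_cst.
  by apply: cvgN; exact: cvg_snd.
have upP p : Q p -> 0 <= p.2 -> (Nx `&` q @^-1` G) (up p).
  by move=> Qp /(up_box p Qp)/KP[_ [[? _] ?] _].
have dnP p : Q p -> p.2 <= 0 -> (Ny `&` q @^-1` G) (dn p).
  by move=> Qp /(dn_box p Qp)/KP'[].
have dn_int p : Q p -> p.2 < 0 -> ~ sbdry R (dn p).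
  move=> Qp p2 bd; have [Ud _ gd] := KP' _ (dn_box p Qp (ltW p2)).
  have := surface_chart_sbdry cg' Ud bd; rewrite gd /= => /eqP.
  by rewrite mulf_eq0 oppr_eq0 (gt_eqF r'0) (lt_eqF p2).
(* [q] identifies distinct points only on the boundary, and [dn p'] is off the boundary when
   [p'.2 < 0]. *)
have up_dn p p' : Q p -> Q p' -> 0 <= p.2 -> p'.2 < 0 -> q (up p) <> q (dn p').
  move=> Qp Qp' p2 p2' /eq_q[E|[_ /dn_int]]; last by move/(_ Qp' p2').
  have : (Nx `&` Ny) (up p).
    by split; [exact: (upP p Qp p2).1|rewrite E; exact: (dnP p' Qp' (ltW p2')).1].
  by rewrite Nxy.
exists f; split.
- rewrite QE; apply: withinU_continuous => //.
    apply: within_continuous_eq cqu => p [_ /= p2].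
    by rewrite /f p2.
  apply: within_continuous_eq cqd => p [Qp /= p2].
  rewrite /f; case: ifPn => // p2'.
  have p20 : p.2 = 0 by apply/eqP; rewrite eq_le p2.
  (* On the common diameter the two halves are [L] and its lift [b], which have the same circle
     index and the same point on it. *)
  rewrite /up /dn p20 !mulr0 oppr0 mulr0 K'tau; last exact: segM.
  have tr := segS _ (segM p Qp); apply/esym/q_eq.
  - exact: Lb.
  - by apply/Bb/bB.
  - rewrite -/(L _) [LHS]surjective_pairing [RHS]surjective_pairing.
    by rewrite (phi1 _ (LB _ tr)) (phi1 _ (bB _ tr)) -/(pr _) -/(pr (b _)) (bP _ tr).2.
- move=> p p'; rewrite !inE => Qp Qp'; rewrite /f.
  case: (leP 0 p.2) => p2; case: (leP 0 p'.2) => p2'.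
  + move=> E; have Eu : up p = up p'.
      have [//|[bu bu' Ephi]] := eq_q _ _ E.
      (* Boundary points of the upper half disc lie on its diameter, inside the sheet [Ux], where
         the attaching map is injective. *)
      have LE s : Q s -> 0 <= s.2 -> sbdry R (up s) -> Ux (up s).
        move=> Qs s2 bs; have [Us _ gs] := KP _ (up_box s Qs s2).
        have := surface_chart_sbdry cg Us bs; rewrite gs /= => s0.
        by rewrite /up s0; apply/LU/segS/segM.
      by apply: injx; rewrite ?inE ?Ephi//; exact: LE.
    have [_ _ gu] := KP _ (up_box p Qp p2).
    have [_ _ gu'] := KP _ (up_box p' Qp' p2').
    move: gu; rewrite -/(up p) Eu gu' => -[/addrI /mulfI E1 /mulfI E2].
    case: p p' E1 E2 {Qp Qp' p2 p2' E Eu gu'} => ? ? [? ?] /= E1 E2.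
    by rewrite E1 ?E2// gt_eqF.
  + by move=> /up_dn; case.
  + by move=> /esym /up_dn; case.
  + move=> /eq_q[Ed|[/dn_int]]; last by case.
    have [_ _ gd] := KP' _ (dn_box p Qp (ltW p2)).
    have [_ _ gd'] := KP' _ (dn_box p' Qp' (ltW p2')).
    move: gd; rewrite -/(dn p) Ed gd' => -[/addrI E1 /mulfI E2].
    have {}E1 := tau_inj _ _ (segM _ Qp') (segM _ Qp) E1.
    move: E1 E2; clear -r10 r'0; case: p p' => u v [u' v'] /= /mulfI E1 E2.
    by rewrite E1 ?gt_eqF// -[v]opprK -E2 ?gt_eqF// opprK.
- by rewrite /f lexx /up /= !mulr0 K0.
- move=> p Qp; rewrite /f; case: ifPn => [p2|].
    by split; [exact: (upP p Qp p2).2|exists (up p)].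
  by rewrite -ltNge => /ltW p2; split; [exact: (dnP p Qp p2).2|exists (dn p)].
Qed.

End Glue.

(** * Pieces of a twisted 2-stratifold *)

Section Stratifold.
Variables (R : realType) (X : topologicalType) (n m : nat).
Variables (M : 'I_n -> topologicalType).
Variables (phi : forall i, M i -> 'I_m * (R * R)).
Variables (q : forall i, M i -> X) (c : 'I_m -> R * R -> X).
Hypothesis strat : twisted_2_stratifold phi q c.
Arguments phi : clear implicits.
Arguments q : clear implicits.

Lemma stratifold_surface i : @surface_with_boundary R (M i).
Proof. by case: strat => -[_ /(_ i)[]]. Qed.

Lemma piece_continuous i : continuous (q i).
Proof.
have [_ _ _ _ [_ _ _ _ [_ oX]]] := strat.
by apply/continuousP => U /oX[+ _]; exact.
Qed.

Lemma piece_inj i (x y : M i) : q i x = q i y ->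
  x = y \/ [/\ sbdry R x, sbdry R y & phi i x = phi i y].
Proof.
have [_ _ _ _ [_ _ qq _ _]] := strat.
by move=> H; have [E|] := qq _ _ _ _ H; [left; exact: eq_from_Tagged E|right].
Qed.

Lemma piece_disjoint i i' (x : M i) (y : M i') : q i x = q i' y -> i != i' ->
  sbdry R x.
Proof.
have [_ _ _ _ [_ _ qq _ _]] := strat.
move=> H ii'; have [E|[]//] := qq _ _ _ _ H.
by case/eqP: ii'; exact: (congr1 (@projT1 _ _) E).
Qed.

(** Points of the circles are covered as well, since their total fibre is nonempty. *)
Lemma piece_cover z : exists i x, q i x = z.
Proof.
have [_ _ fib _ [cov qc _ _ _]] := strat.
have [//|[j [p [Sp <-]]]] := cov z.
have [[i x] [_ [_ [[bx phix] _ _ _]]]] := fib j p Sp.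
by exists i, x; rewrite (qc i x bx) phix.
Qed.

Lemma closed_piece i : closed (range (q i)).
Proof.
have [[[hX cX _] /(_ i)[_ cM _ _ _]] _ _ _ _] := strat.
apply: compact_closed => //; apply: continuous_compact => //.
exact: continuous_subspaceT (@piece_continuous i).
Qed.

(** Only boundary points are identified, so the image of [U] pulls back to [U] itself in [M i] and
    to the empty set in the other pieces and the circles. *)
Lemma piece_interior_open i (U : set (M i)) :
  open U -> U `<=` ~` @sbdry R (M i) -> open (q i @` U).
Proof.
move=> Uo Ub; have [_ _ _ _ [_ _ qq _ [qc oX]]] := strat.
apply/oX; split => [i'|j].
  have [<-|ii'] := eqVneq i i'.
    rewrite (_ : _ @^-1` _ = U)//; apply/seteqP; split => [y [x Ux]|x Ux]; last by exists x.
    by move=> /piece_inj[<-//|[/(Ub x Ux)]].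
  rewrite (_ : _ @^-1` _ = set0); first exact: open0.
  apply/seteqP; split => // y [x Ux /piece_disjoint] /(_ ii').
  exact: Ub Ux.
exists set0; split; first exact: open0.
rewrite set0I; apply/seteqP; split => // p [Sp [x Ux]].
by move=> /(qc _ _ _ _ Sp); exact: Ub Ux.
Qed.

Lemma piece_interior_homeo i (U : set (M i)) :
  open U -> U `<=` ~` @sbdry R (M i) -> homeo_onto U (q i) (q i @` U).
Proof.
move=> Uo Ub; split => //.
- by move=> x y; rewrite inE => /Ub bx _ /piece_inj[//|[/bx]].
- exact: continuous_subspaceT (@piece_continuous i).
- move=> V Vo; exists (q i @` (V `&` U)); split.
    apply: piece_interior_open; first exact: openI.
    by move=> x [_ /Ub].
  apply/seteqP; split => [_ [x [Vx Ux] <-]|z []//].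
  by split; exists x.
Qed.

(* On the singular circles this is where the degrees different from 1 and -1
   are used: two sheets of the same piece meet there. *)
Lemma piece_disc i (x : M i) G : nbhs (q i x) G ->
  disc_at R (G `&` range (q i)) (q i x).
Proof.
move=> Gx; have sM := @stratifold_surface i; have cq := @piece_continuous i.
have [[_ /(_ i)[hM _ _ _ _]] cov _ tw [_ qc _ _ _]] := strat.
have [bx|nbx] := pselect (sbdry R x).
  have [y [By yx phiy]] := tw i x bx; have [phi1 covx] := cov i x bx.
  apply: (@glued_disc _ _ _ _ (phi i) _ x y) => //.
  - by move=> u v bu bv E; rewrite !qc// E.
  - exact: piece_inj.
have [U [g [[Uo Ux] UG _ _ Ud]]] := interior_chart sM (cq x _ Gx) nbx.
have Ub : U `<=` ~` @sbdry R (M i) by move=> u /UG[].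
have [injq _ cqU _] := piece_interior_homeo Uo Ub.
have := disc_at_image cqU injq (Ud x U Ux (open_mem_nbhs Uo Ux)).
by apply: disc_at_mono => _ [u /UG[Gu _] <-]; split => //; exists u.
Qed.

Lemma piece_not_only_sbdry i (x : M i) G : nbhs (q i x) G ->
  exists2 y, G (q i y) & ~ sbdry R y.
Proof. by move=> /piece_continuous; exact: sbdry_approx (@stratifold_surface i). Qed.

(** Off the circles the chart domain is open in [X] itself, so arbitrary nearby points of [X] can be
    compared with the plane. *)
Lemma piece_open_chart i (y : M i) G : nbhs (q i y) G -> ~ sbdry R y ->
  exists O (g : X -> R * R), [/\ open O /\ O (q i y), O `<=` G `&` range (q i),
    {within O, continuous g}, {in O &, injective g} &
    forall z (G' : set X), O z -> nbhs z G' -> disc_at R G' z].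
Proof.
move=> Gy nby; have sM := @stratifold_surface i; have cq := @piece_continuous i.
have [U [g [[Uo Uy] UG cg injg Ud]]] := interior_chart sM (cq y _ Gy) nby.
have Ub : U `<=` ~` @sbdry R (M i) by move=> u /UG[].
have hU := piece_interior_homeo Uo Ub; have [injq _ cqU _] := hU.
have [k [kV kq ck]] := homeo_onto_inverse y hU.
exists (q i @` U), (g \o k); split.
- by split; [exact: piece_interior_open|exists y].
- by move=> _ [u /UG[Gu _] <-]; split => //; exists u.
- exact: within_continuous_comp (fun v Ov => (kV v Ov).1) ck cg.
- move=> v v'; rewrite !inE => Ov Ov' /injg E.
  by rewrite -(kV v Ov).2 -(kV v' Ov').2 E// inE; apply: (kV _ _).1.
- move=> _ G' [u Uu <-] G'u.
  have nu : nbhs u (U `&` q i @^-1` G').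
    by apply: filterI; [exact: open_mem_nbhs|exact: cq].
  have sub : U `&` q i @^-1` G' `<=` U by move=> ? [].
  have inj' : {in U `&` q i @^-1` G' &, injective (q i)}.
    by move=> v v'; rewrite !inE => -[? _] [? _]; apply: injq; rewrite inE.
  have := disc_at_image (continuous_subspaceW sub cqU) inj' (Ud u _ Uu nu).
  by apply: disc_at_mono => _ [v [_ ?] <-].
Qed.

Lemma piece_nonempty i : exists x : M i, True.
Proof. by case: strat => -[_ /(_ i)[_ _ _ [x _] _]] *; exists x. Qed.

End Stratifold.

(** * Triangulations *)

Section Realization.
Variables (R : realType) (X : topologicalType) (N : nat).
Variables (K : {set {set 'I_N}}) (h : X -> 'rV[R]_N).
Hypothesis simpK : simplicial_complex K.
Hypothesis hK : homeo_onto [set: X] h (@geom_real R N K).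

(** The carrier of [z]: the simplex whose open cell contains [h z]. *)
Definition supp z : {set 'I_N} := finset.finset (fun k => h z 0 k != 0).

Lemma in_supp z k : (k \in supp z) = (h z 0 k != 0).
Proof. by rewrite finset.inE. Qed.

Lemma real_pt z : geom_real K (h z).
Proof. by have [_ <- _ _] := hK; exists z. Qed.

Lemma supp_K z : supp z \in K.
Proof. by have [] := real_pt z. Qed.

Lemma coord_ge0 z k : 0 <= h z 0 k.
Proof. by have [] := real_pt z. Qed.

Lemma coord_sum z : \sum_k h z 0 k = 1.
Proof. by have [] := real_pt z. Qed.

Lemma coord_gt0 z k : k \in supp z -> 0 < h z 0 k.
Proof. by rewrite in_supp lt_neqAle eq_sym => ->; exact: coord_ge0. Qed.

Lemma coord_out z k : k \notin supp z -> h z 0 k = 0.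
Proof. by rewrite in_supp negbK => /eqP. Qed.

Lemma supp_neq0 z : exists a, a \in supp z.
Proof. by have [/(_ _ (supp_K z)) /set0Pn ? _] := simpK. Qed.

Lemma real_continuous k : continuous (fun z => h z 0 k).
Proof.
have [_ _ ch _] := hK; move=> z W Wz.
have nW : nbhs (h z) (fun v : 'rV_N => W (v 0 k)) by exact: (coord_continuous Wz).
by apply: filterS (within_nbhs ch I nW) => y; exact.
Qed.

Lemma real_ext d z w : (forall k, k != d -> h z 0 k = h w 0 k) -> z = w.
Proof.
move=> E; have [injh _ _ _] := hK; apply: injh; rewrite ?inE//.
apply/rowP => k; have [->|/E//] := eqVneq k d.
have := coord_sum z; rewrite -(coord_sum w) (bigD1 d)// [in RHS](bigD1 d)//=.
by rewrite (eq_bigr _ E) => /addIr.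
Qed.

(** Open stars are open: finitely many coordinates stay positive. *)
Lemma star_nbhs (s : {set 'I_N}) z : s \subset supp z ->
  nbhs z [set w | s \subset supp w].
Proof.
move=> sz; have : nbhs z [set w | forall k, k \in s -> k \in supp w].
  apply: filter_forall => k.
  have [ks|ks] := boolP (k \in s); last by apply: filterE => w.
  have zk : nbhs (h z 0 k) [set x | 0 < x].
    by apply: open_mem_nbhs (@open_gt R 0) _; apply: coord_gt0; exact: (fintype.subsetP sz).
  have nz : nbhs z (fun w => 0 < h w 0 k) by exact: real_continuous zk.
  apply: filterS nz => w wk _.
  by rewrite in_supp gt_eqF.
by apply: filterS => w H; apply/fintype.subsetP.
Qed.

(** Lets paths and slices be written in barycentric coordinates and then transported to [X]. *)
Lemma realize (T : topologicalType) (A : set T) (v : T -> 'rV[R]_N) (z0 : X) :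
  (forall k, {within A, continuous (fun a => v a 0 k)}) ->
  (forall a, A a -> geom_real K (v a)) ->
  exists2 w : T -> X, {within A, continuous w} & forall a, A a -> h (w a) = v a.
Proof.
move=> cv vK; have [k [kK _ ck]] := homeo_onto_inverse z0 hK.
exists (k \o v); last by move=> a /vK/kK[].
apply: within_continuous_comp vK _ ck.
apply/subspace_continuousP => a Aa W [P nP PW].
have : nbhs a [set b | forall j, A b -> P 0 j (v b 0 j)].
  by apply: filter_forall => j; exact: within_nbhs (cv j) Aa (nP 0 j).
by apply: filterS => b H Ab; apply: PW => i j; rewrite ord1; exact: H.
Qed.

Lemma coord_lower z : exists2 e, 0 < e & forall k, k \in supp z -> e <= h z 0 k.
Proof.
have [a az] := supp_neq0 z.
exists (h z 0 [arg min_(k < a in supp z) h z 0 k]%O).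
  by case: Order.TotalTheory.arg_minP => // k kz _; exact: coord_gt0.
by case: Order.TotalTheory.arg_minP => // k kz H j; exact: H.
Qed.

Lemma face_point (s : {set 'I_N}) : s \in K -> exists z, supp z = s.
Proof.
move=> sK; have [/(_ s sK) s0 _] := simpK.
have s1 : 0 < #|s|%:R :> R by rewrite ltr0n card_gt0.
(* The barycenter of [s]. *)
pose v : 'rV[R]_N := \row_k ((k \in s)%:R / #|s|%:R).
have sv : finset.finset (fun k => v 0 k != 0) = s.
  apply/setP => k; rewrite finset.inE mxE mulf_eq0 invr_eq0 (gt_eqF s1) orbF.
  by case: (k \in s); rewrite ?eqxx ?oner_eq0.
have vK : geom_real K v.
  split; last by rewrite sv.
    by move=> k; rewrite mxE divr_ge0 ?ler0n.
  under eq_bigr do rewrite mxE.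
  rewrite -mulr_suml -natr_sum (_ : (\sum_k (k \in s))%N = #|s|).
    by rewrite divff// gt_eqF.
  by rewrite -sum1_card [RHS]big_mkcond.
have [_ hE _ _] := hK; move: vK; rewrite -hE => -[z _ hz].
by exists z; rewrite /supp hz.
Qed.

(** The straight segment in coordinates: it enters the open cell of [z1] immediately, because every
    vertex of [z1] gets positive weight once [s > 0]. *)
Lemma segment_path z0 z1 : supp z0 \subset supp z1 ->
  exists w : R -> X, [/\ {within `[0, 1], continuous w}, w 0 = z0, w 1 = z1 &
    forall s, 0 < s <= 1 -> supp (w s) = supp z1].
Proof.
move=> z01.
pose v (s : R) : 'rV[R]_N := \row_k ((1 - s) * h z0 0 k + s * h z1 0 k).
have sv s : 0 < s <= 1 -> finset.finset (fun k => v s 0 k != 0) = supp z1.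
  move=> /andP[s0 s1]; apply/setP => k; rewrite in_supp finset.inE mxE.
  have [kz|kz] := boolP (k \in supp z1).
    have kz1 := coord_gt0 kz; rewrite (gt_eqF kz1) gt_eqF//.
    have := coord_ge0 z0 k; nra.
  rewrite (coord_out kz) (coord_out (contra (fintype.subsetP z01 k) kz)).
  by rewrite !mulr0 addr0.
have v0 : v 0 = h z0 by apply/rowP => k; rewrite mxE subr0 mul1r mul0r addr0.
have v1 : v 1 = h z1 by apply/rowP => k; rewrite mxE subrr mul1r mul0r add0r.
have vK s : `[0, 1]%classic s -> geom_real K (v s).
  rewrite /= in_itv /= le_eqVlt => /andP[/orP[/eqP<- _|s0 s1]].
    by rewrite v0; exact: real_pt.
  split; last by rewrite sv ?s0// supp_K.
    move=> k; rewrite mxE; have := coord_ge0 z0 k; have := coord_ge0 z1 k; nra.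
  under eq_bigr do rewrite mxE.
  by rewrite big_split /= -!mulr_sumr !coord_sum !mulr1 subrK.
have cv k : {within `[0, 1], continuous (fun s => v s 0 k)}.
  apply: continuous_subspaceT => s.
  rewrite (_ : (fun s => _) = fun s : R => (1 - s) * h z0 0 k + s * h z1 0 k); last first.
    by apply/funext => u; rewrite mxE.
  apply: cvgD; apply: cvgM; try exact: cvg_cst; last exact: cvg_id.
  by apply: cvgB; [exact: cvg_cst|exact: cvg_id].
have [w cw hw] := realize z0 cv vK.
have [injh _ _ _] := hK.
have i0 : `[0, 1]%classic (0 : R) by rewrite /= in_itv /= lexx ler01.
have i1 : `[0, 1]%classic (1 : R) by rewrite /= in_itv /= lexx ler01.
exists w; split => //.
- by apply: injh; rewrite ?inE// hw// v0.
- by apply: injh; rewrite ?inE// hw// v1.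
- move=> s s01; rewrite -(sv s s01) /supp hw//= in_itv /=.
  by case/andP: s01 => /ltW -> ->.
Qed.

End Realization.

(** * No simplex has dimension 3 or more *)

Section Triangulation.
Variables (R : realType) (X : topologicalType) (n m : nat).
Variables (M : 'I_n -> topologicalType).
Variables (phi : forall i, M i -> 'I_m * (R * R)).
Variables (q : forall i, M i -> X) (c : 'I_m -> R * R -> X).
Variables (N : nat) (K : {set {set 'I_N}}) (h : X -> 'rV[R]_N).
Hypothesis strat : twisted_2_stratifold phi q c.
Hypothesis simpK : simplicial_complex K.
Hypothesis hK : homeo_onto [set: X] h (@geom_real R N K).
Arguments phi : clear implicits.
Arguments q : clear implicits.
Local Notation Q := (@square R).
Local Notation supp := (supp h).

Lemma nbhs_cube (W : set ((R * R) * R)) : nbhs (((0, 0), 0) : (R * R) * R) W ->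
  exists2 r, 0 < r &
    forall p u, Q p -> -1 <= u <= 1 -> W ((r * p.1, r * p.2), r * u).
Proof.
move=> /nbhs_ballP[e /= e0 eW]; exists (e / 2); first by rewrite divr_gt0.
have small x : -1 <= x <= 1 -> `|0 - e / 2 * x| < e.
  by move=> /andP[? ?]; rewrite ltr_norml; apply/andP; split; nra.
by move=> p u [p1 p2] u1; apply: eW; split; [split|]; exact: small.
Qed.

Lemma coord_pair_continuous a b : continuous (fun z : X => (h z 0 a, h z 0 b)).
Proof.
move=> z; apply: (@cvg_pair _ _ _ _ (nbhs _) (nbhs _));
  exact: (real_continuous hK).
Qed.

(* A plane slice through an interior point of a simplex of dimension at least 3
   would be a neighborhood in the surface, which the simplex leaves in a third
   direction. *)
Lemma card_simplex_le3 s : s \in K -> (#|s| <= 3)%N.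
Proof.
move=> s0K; rewrite leqNgt; apply/negP => s03.
(* For a simplex of largest cardinality the open star is just its open cell. *)
pose t := [arg max_(t > s in K) #|t|].
have [tK tmax] : t \in K /\ forall t', t' \in K -> (#|t'| <= #|t|)%N.
  by rewrite /t; case: arg_maxnP.
have {s03} t3 : (3 < #|t|)%N by apply: leq_trans (tmax _ s0K).
have tsupp w : t \subset supp w -> supp w = t.
  by move=> tw; apply/esym/eqP; rewrite eqEcard tw tmax// supp_K.
have [z1 z1t] := face_point simpK hK tK.
have [i [x qx]] := piece_cover strat z1.
have nst : nbhs (q i x) [set w | t \subset supp w].
  by apply: (star_nbhs hK); rewrite qx z1t.
have [y ty nby] := piece_not_only_sbdry strat nst.
have nst' : nbhs (q i y) [set w | t \subset supp w] by exact: (star_nbhs hK).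
have [A [g [[Ao Ay] _ cg injg _]]] := piece_open_chart strat nst' nby.
move: (q i y) ty Ay {nst nst' nby qx x z1t} => z tz Az.
have {}tz := tsupp _ tz.
have [e [et e3]] : exists e, e \in t /\ (2 < #|t :\ e|)%N.
  have [e et] : exists e, e \in t by apply/card_gt0P; apply: leq_trans t3.
  by exists e; split => //; move: t3; rewrite (cardsD1 e) et.
have /card_gt2P[a [b [d [[]]]]] := e3.
rewrite !in_setD1 => /andP[ae at_] /andP[be bt] /andP[de dt] [ab bd da].
have [r r0 rz] := coord_lower simpK hK z.
(* Moves [z] in the directions [a], [b], [d], with vertex [e] absorbing the change of the sum. *)
pose v (p : (R * R) * R) : 'rV[R]_N := \row_k (h z 0 k + p.1.1 * (k == a)%:R +
  p.1.2 * (k == b)%:R + p.2 * (k == d)%:R - (p.1.1 + p.1.2 + p.2) * (k == e)%:R).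
(* With [r / 8] every coordinate in [t] drops by less than [6 * r / 8], whichever of the four
   vertices it is compared with, and stays positive. *)
pose A0 : set ((R * R) * R) := [set p | [/\ `|p.1.1| < r / 8, `|p.1.2| < r / 8 & `|p.2| < r / 8]].
have ind k j : j \in t -> k \notin t -> (k == j)%:R = 0 :> R.
  by move=> jt; case: eqP => // ->; rewrite jt.
have b01 (b' : bool) : b'%:R = 0 :> R \/ b'%:R = 1 :> R by case: b'; [right|left].
have vin p k : A0 p -> k \in t -> 0 < v p 0 k.
  move=> [p1 p2 p3] kt; rewrite mxE.
  have := rz k; rewrite tz => /(_ kt) hk.
  move: p1 p2 p3; rewrite !ltr_norml => /andP[? ?] /andP[? ?] /andP[? ?].
  by case: (b01 (k == a)) => ->; case: (b01 (k == b)) => ->;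
    case: (b01 (k == d)) => ->; case: (b01 (k == e)) => ->; lra.
have vout p k : k \notin t -> v p 0 k = 0.
  move=> kt; rewrite mxE !(ind k)// (coord_out _) ?tz//.
  by rewrite !mulr0 !addr0 subrr.
have vK p : A0 p -> geom_real K (v p).
  move=> Ap; split.
  - by move=> k; have [kt|kt] := boolP (k \in t); [exact/ltW/vin|rewrite vout].
  - under eq_bigr do rewrite mxE.
    have one (j : 'I_N) : \sum_k (k == j)%:R = 1 :> R.
      by rewrite (bigD1 j)//= eqxx big1 ?addr0// => k /negbTE ->.
    by rewrite sumrB !big_split /= -!mulr_sumr !one (coord_sum hK) !mulr1; lra.
  - rewrite (_ : finset.finset _ = t)//; apply/setP => k; rewrite finset.inE.
    by have [kt|kt] := boolP (k \in t); [rewrite gt_eqF// vin|rewrite vout// eqxx].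
have cv k : {within A0, continuous (fun p => v p 0 k)}.
  apply: continuous_subspaceT => p.
  rewrite (_ : (fun p => _) = fun p : (R * R) * R =>
    h z 0 k + p.1.1 * (k == a)%:R + p.1.2 * (k == b)%:R + p.2 * (k == d)%:R -
    (p.1.1 + p.1.2 + p.2) * (k == e)%:R); last by apply/funext => u; rewrite mxE.
  have c1 : (fun p : (R * R) * R => p.1.1) @ p --> p.1.1.
    by apply: (@continuous_comp _ _ _ fst fst); exact: cvg_fst.
  have c2 : (fun p : (R * R) * R => p.1.2) @ p --> p.1.2.
    by apply: (@continuous_comp _ _ _ fst snd); [exact: cvg_fst|exact: cvg_snd].
  have c3 : (fun p : (R * R) * R => p.2) @ p --> p.2 by exact: cvg_snd.
  have cc : forall f (x : R), f @ p --> (f p : R) -> (fun p : (R * R) * R => f p * x) @ p --> f p * x.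
    by move=> f x0 cf; apply: cvgM; [exact: cf|exact: cvg_cst].
  apply: cvgB; last by apply: (cc (fun p => p.1.1 + p.1.2 + p.2)); do ?apply: cvgD.
  apply: cvgD; last exact: (cc (fun p => p.2)).
  apply: cvgD; last exact: (cc (fun p => p.1.2)).
  by apply: cvgD; [exact: cvg_cst|exact: (cc (fun p => p.1.1))].
have [w cw hw] := realize hK z cv vK.
have [injh _ _ _] := hK.
have A00 : A0 ((0, 0), 0) by split; rewrite /= normr0 divr_gt0.
have v0 : v ((0, 0), 0) = h z.
  by apply/rowP => k; rewrite mxE /= !mul0r !addr0 mul0r subr0.
have w0 : w ((0, 0), 0) = z by apply: injh; rewrite ?inE// hw.
have nA0 : nbhs (((0, 0), 0) : (R * R) * R) A0.
  apply/nbhs_ballP; exists (r / 8) => /=; first by rewrite divr_gt0.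
  move=> [[x1 x2] x3] [[/= + +] +]; rewrite /ball /= !sub0r !normrN.
  by move=> ? ? ?; split.
pose P := A `&` [set y | h y 0 d = h z 0 d].
have nA : nbhs z A by exact: open_mem_nbhs.
have disc : disc_at R P z.
  have : nbhs (w ((0, 0), 0)) A by rewrite w0.
  move=> /(within_nbhs cw A00)/(filterI nA0)/nbhs_cube[l l0 lP].
  have i0 : -1 <= (0 : R) <= 1 by rewrite lerN10 ler01.
  have slice p : Q p -> A0 ((l * p.1, l * p.2), l * 0) /\ A (w ((l * p.1, l * p.2), l * 0)).
    by move=> Qp; have [Ap /(_ Ap)] := lP p 0 Qp i0.
  exists (fun p => w ((l * p.1, l * p.2), l * 0)); split.
  - apply: (within_continuous_comp (f := fun p : R * R => ((l * p.1, l * p.2), l * 0)) (B := A0)) => //.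
      by move=> p /slice[].
    apply: continuous_subspaceT => p; apply: (@cvg_pair _ _ _ _ (nbhs _) (nbhs _));
      last exact: cvg_cst.
    by apply: (@cvg_pair _ _ _ _ (nbhs _) (nbhs _)); apply: cvgM;
      [exact: cvg_cst|exact: cvg_fst|exact: cvg_cst|exact: cvg_snd].
  - move=> p p'; rewrite !inE => Qp Qp' E.
    have : v (l * p.1, l * p.2, l * 0) = v (l * p'.1, l * p'.2, l * 0).
      by rewrite -!hw ?E//; [exact: (slice p' Qp').1|exact: (slice p Qp).1].
    move=> /rowP Ev; have := Ev a; have := Ev b; rewrite !mxE /= !eqxx.
    rewrite (negPf ab) (eq_sym b a) (negPf ab) (negPf bd) (negPf be) (negPf ae).
    rewrite (eq_sym a d) (negPf da) => E2 E1.
    case: p p' E1 E2 {Qp Qp' E Ev} => [p1 p2] [p1' p2'] /= E1 E2.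
    by congr (_, _); apply: (@mulfI _ l); rewrite ?gt_eqF//; lra.
  - by rewrite /= !mulr0.
  - move=> p Qp; split; first exact: (slice p Qp).2.
    rewrite /= hw; last exact: (slice p Qp).1.
    by rewrite mxE /= mulr0 (negPf de) (negPf da) (eq_sym d b) (negPf bd); lra.
have PA : P `<=` A by move=> ? [].
have injP : {in P &, injective g}.
  by move=> u u'; rewrite !inE => -[? _] [? _]; apply: injg; rewrite inE.
have := invariance_of_domain disc (continuous_subspaceW PA cg) injP.
move=> /(within_nbhs cg Az)/(filterI nA); rewrite -[X in nbhs X _]w0.
move=> /(within_nbhs cw A00)/(filterI nA0)/nbhs_cube[l l0 lP].
have Q0 : Q 0 by split => /=; rewrite lerN10 ler01.
have i1 : -1 <= (1 : R) <= 1 by rewrite lexx andbT; lra.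
(* The point displaced by [l] in direction [d] has its chart value in the image of the slice, so by
   injectivity it lies in the slice, although its coordinate at [d] has changed. *)
have [Ap /(_ Ap)[Aw /(_ Aw)[u [Au ud] /injg E]]] := lP 0 1 Q0 i1.
have {}E : u = w ((l * (0 : R * R).1, l * (0 : R * R).2), l * 1).
  by apply: E; rewrite inE.
move: ud; rewrite /= E hw// mxE /= mulr0 mulr1 eqxx (negPf de) (negPf da).
by rewrite (eq_sym d b) (negPf bd) mulr1n !mulr0n; lra.
Qed.

End Triangulation.

(** * The triangles of a piece *)

Section Faces.
Variables (R : realType) (X : topologicalType) (n m : nat).
Variables (M : 'I_n -> topologicalType).
Variables (phi : forall i, M i -> 'I_m * (R * R)).
Variables (q : forall i, M i -> X) (c : 'I_m -> R * R -> X).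
Variables (N : nat) (K : {set {set 'I_N}}) (h : X -> 'rV[R]_N).
Hypothesis strat : twisted_2_stratifold phi q c.
Hypothesis simpK : simplicial_complex K.
Hypothesis hK : homeo_onto [set: X] h (@geom_real R N K).
Arguments phi : clear implicits.
Arguments q : clear implicits.
Local Notation Q := (@square R).
Local Notation supp := (supp h).

Lemma supp_le3 z : (#|supp z| <= 3)%N.
Proof. exact: (card_simplex_le3 strat simpK hK (supp_K hK z)). Qed.

Lemma supp_max (t : {set 'I_N}) z : #|t| = 3 -> t \subset supp z -> supp z = t.
Proof. by move=> t3 tz; apply/esym/eqP; rewrite eqEcard tz t3 supp_le3. Qed.

Lemma third_vertex (t : {set 'I_N}) a b : #|t| = 3 -> a \in t -> b \in t -> a != b ->
  exists d, [/\ d \in t, d != a, d != b & forall k, k \in t -> [\/ k = a, k = b | k = d]].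
Proof.
move=> t3 at_ bt ab; have ba : b \in t :\ a by rewrite in_setD1 bt eq_sym ab.
have : #|t :\ a :\ b| = 1%N.
  by move: t3; rewrite (cardsD1 a) at_ (cardsD1 b) ba => -[].
move=> /eqP/cards1P[d td]; exists d.
have : d \in t :\ a :\ b by rewrite td finset.inE.
rewrite !in_setD1 => /and3P[db da dt]; split => // k kt.
have [->|ka] := eqVneq k a; first exact: Or31.
have [->|kb] := eqVneq k b; first exact: Or32.
have : k \in t :\ a :\ b by rewrite !in_setD1 ka kb.
by rewrite td finset.inE => /eqP->; exact: Or33.
Qed.

(** At a point of a planar chart whose carrier is largest, a neighborhood lies in one open cell.
    With at most two vertices, one coordinate would be injective there and put a disc into a
    line. *)
Lemma piece_has_triangle i : exists z, range (q i) z /\ #|supp z| = 3.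
Proof.
have [x _] := piece_nonempty strat i.
have [y _ nby] := piece_not_only_sbdry strat (x := x) filterT.
have [A [g [[Ao Ay] AG _ _ Ad]]] := piece_open_chart strat (y := y) filterT nby.
pose S (s : {set 'I_N}) := `[<exists2 z, A z & supp z = s>].
have S0 : S (supp (q i y)) by apply/asboolP; exists (q i y).
have [w Aw wmax] : exists2 w, A w & forall z, A z -> (#|supp z| <= #|supp w|)%N.
  case: (arg_maxnP (fun s : {set 'I_N} => #|s|) S0) => s /asboolP[w Aw ws] smax.
  by exists w => // z Az; rewrite ws; apply: smax; apply/asboolP; exists z.
exists w; split; first exact: (AG w Aw).2.
apply/eqP; rewrite eqn_leq supp_le3 ltnNge; apply/negP => w2.
pose P := A `&` [set z | supp w \subset supp z].
have Pw z : P z -> supp z = supp w.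
  by move=> [Az wz]; apply/esym/eqP; rewrite eqEcard wz wmax.
have nP : nbhs w P by apply: filterI; [exact: open_mem_nbhs|exact: (star_nbhs hK)].
have [a aw] := supp_neq0 simpK hK w.
(* [d] is the second vertex of the carrier, or [a] again if there is none. *)
have [d ad] : exists d, forall k, k \in supp w -> k = a \/ k = d.
  have : (#|supp w :\ a| <= 1)%N by move: w2; rewrite (cardsD1 a) aw ltnS.
  rewrite leq_eqVlt ltnS leqn0 cards_eq0 => /orP[/cards1P[d E]|/eqP E].
    exists d => k kw; have [->|ka] := eqVneq k a; [by left|right].
    have : k \in supp w :\ a by rewrite in_setD1 ka.
    by rewrite E finset.inE => /eqP.
  exists a => k kw; left; apply/eqP/negPn/negP => ka.
  have : k \in supp w :\ a by rewrite in_setD1 ka.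
  by rewrite E finset.inE.
apply: (@not_nbhs_halfplane R (h w 0 a, 0) ((fun z => (h z 0 a, 0)) @` P)) => //.
  by move=> _ [z _ <-]; rewrite /halfplane /=.
apply: (invariance_of_domain (g := fun z => (h z 0 a, 0)) (Ad w P Aw nP)).
  apply: continuous_subspaceT => z.
  apply: (@cvg_pair _ _ _ _ (nbhs _) (nbhs _)); last exact: cvg_cst.
  exact: (real_continuous hK).
move=> z z'; rewrite !inE => /Pw zw /Pw zw' [E].
apply: (real_ext hK (d := d)) => k kd; have [kw|kw] := boolP (k \in supp w).
  by case: (ad k kw) => [->//|kd']; rewrite kd' eqxx in kd.
by rewrite !(coord_out (h := h)) ?zw ?zw'.
Qed.

(** Two barycentric coordinates map the open triangle injectively to the plane, so by invariance of
    domain the disc of the piece at [z] fills a neighborhood. *)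
Lemma piece_face_nbhs i z : #|supp z| = 3 -> range (q i) z -> nbhs z (range (q i)).
Proof.
move=> z3 [x _ qx].
have nst : nbhs (q i x) [set w | supp z \subset supp w].
  by apply: (star_nbhs hK); rewrite qx.
have := piece_disc strat nst; rewrite qx => D.
have /card_gt1P[a [b [az bz ab]]] : (1 < #|supp z|)%N by rewrite z3.
have [d [dz da db dP]] := third_vertex z3 az bz ab.
pose pr w := (h w 0 a, h w 0 b).
have pr_inj w w' : supp w = supp z -> supp w' = supp z -> pr w = pr w' -> w = w'.
  move=> wz wz' [Ea Eb]; apply: (real_ext hK (d := d)) => k kd.
  have [kz|kz] := boolP (k \in supp z).
    by case: (dP k kz) => [->|->|kd'] //; rewrite kd' eqxx in kd.
  by rewrite !(coord_out (h := h)) ?wz ?wz'.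
have cpr : continuous pr by exact: coord_pair_continuous hK a b.
have inj : {in [set w | supp z \subset supp w] `&` range (q i) &, injective pr}.
  move=> w w'; rewrite !inE => -[/= wz _] [/= wz' _].
  by apply: pr_inj; exact: supp_max.
have := invariance_of_domain D (continuous_subspaceT cpr) inj.
move=> /(cpr z) nz; have nst' := star_nbhs hK (subxx (supp z)).
have {}nz : nbhs z (fun w => (pr @` ([set w | supp z \subset supp w] `&` range (q i))) (pr w)) by [].
apply: filterS (filterI nz nst') => w [[w' [w'z w'q] E] wz].
by rewrite -(pr_inj w' w _ _ E)//; exact: supp_max.
Qed.

(** The image of the piece is open and closed in the open triangle, which is connected by
    segments. *)
Lemma piece_face_full i z z' : #|supp z| = 3 -> supp z' = supp z ->
  range (q i) z -> range (q i) z'.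
Proof.
move=> z3 zz' qz; have [|w [cw w0 w1 ws]] := segment_path hK (z0 := z) (z1 := z').
  by rewrite zz'.
pose C := w @` `[0, 1].
have i0 : `[0, 1]%classic (0 : R) by rewrite /= in_itv /= lexx ler01.
have i1 : `[0, 1]%classic (1 : R) by rewrite /= in_itv /= lexx ler01.
have Cs y : C y -> supp y = supp z.
  move=> [s]; rewrite /= in_itv /= le_eqVlt => /andP[/orP[/eqP<- _|s0 s1]] <-.
    by rewrite w0.
  by rewrite ws ?s0// zz'.
have cC : connected C.
  by apply: connected_continuous_connected cw; exact: segment_connected.
pose G := [set y | supp y = supp z] `&` range (q i).
have CG : C `&` range (q i) = C.
  apply: cC.
  - by exists z; split => //; exists 0.
  - exists G; last first.
      by apply/seteqP; split => y [Cy]; [move=> ?; split => //; split => //; exact: Cs|case].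
    rewrite openE => y [yz qy]; rewrite /interior.
    have y3 : #|supp y| = 3 by rewrite yz.
    have nst := star_nbhs hK (subxx (supp y)).
    apply: filterS (filterI nst (piece_face_nbhs y3 qy)) => u [uy qu].
    by split => //=; rewrite -yz; exact: supp_max.
  - by exists (range (q i)) => //; exact: closed_piece strat i.
have : C z' by exists 1.
by rewrite -CG => -[].
Qed.

(** One point of the open cell is enough here: by [piece_face_full] the whole cell then lies in the
    image. *)
Definition piece_triangles i : {set {set 'I_N}} :=
  finset.finset (fun t => `[<exists z, [/\ supp z = t, #|t| = 3 & range (q i) z]>]).

Lemma in_piece_triangles i t : t \in piece_triangles i <->
  exists z, [/\ supp z = t, #|t| = 3 & range (q i) z].
Proof. by rewrite finset.inE; split => /asboolP. Qed.

(** The open triangle contains the image of a non-boundary point of [M i], and such a point lies in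
    no other piece. *)
Lemma piece_triangles_disjoint i i' t :
  t \in piece_triangles i -> t \in piece_triangles i' -> i = i'.
Proof.
move=> /in_piece_triangles[z [zt t3 [x _ qx]]] /in_piece_triangles[z' [zt' _ qz']].
apply/eqP/negPn/negP => ii'.
have nst : nbhs (q i x) [set w | t \subset supp w].
  by apply: (star_nbhs hK); rewrite qx zt.
have [y /= ty nby] := piece_not_only_sbdry strat nst.
have z3 : #|supp z'| = 3 by rewrite zt'.
have [|y' _ E] := piece_face_full (z' := q i y) z3 _ qz'.
  by rewrite zt'; exact: supp_max.
by apply: nby; apply: (piece_disjoint strat (esym E) ii').
Qed.

(* Otherwise the disc of the piece around a point of [e] would lie in the
   closed half plane spanned by [t] on one side of [e]. *)
Lemma edge_in_other_triangle i t (e : {set 'I_N}) :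
  t \in piece_triangles i -> e \subset t -> #|e| = 2 ->
  exists t', [/\ t' \in piece_triangles i, t' != t & e \subset t'].
Proof.
move=> tT et e2; apply: contrapT => /forallNP nE.
have [z [zt t3 qz]] := (in_piece_triangles i t).1 tT.
have eK : e \in K.
  have [_ sub] := simpK; apply: sub et _; first by rewrite -zt supp_K.
  by rewrite -card_gt0 e2.
have [y ye] := face_point simpK hK eK.
have qy : range (q i) y.
  apply: contrapT => nqy.
  have [|w [cw w0 w1 ws]] := segment_path hK (z0 := y) (z1 := z).
    by rewrite ye zt.
  have ny : nbhs (w 0) (~` range (q i)).
    rewrite w0; apply: open_mem_nbhs => //; apply: closed_openC.
    exact: closed_piece strat i.
  have i0 : `[0, 1]%classic (0 : R) by rewrite /= in_itv /= lexx ler01.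
  have /nbhs_ballP[r /= r0 rP] := within_nbhs cw i0 ny.
  (* A parameter so small that [w s] is still off the closed image of the piece, yet positive, so
     that [w s] is in the open triangle. *)
  pose s := Num.min (r / 2) 1.
  have s0 : 0 < s by rewrite lt_min divr_gt0 //= ltr01.
  have s1 : s <= 1 by rewrite ge_min lexx orbT.
  have sr : s < r.
    by apply: (@le_lt_trans _ _ (r / 2)); [rewrite ge_min lexx|lra].
  apply: (rP s) => //.
  - by rewrite /ball /= sub0r normrN gtr0_norm.
  - by rewrite in_itv /= s1 ltW.
  - have sz : supp (w s) = supp z by apply: ws; rewrite s0.
    by apply: piece_face_full sz qz; rewrite zt.
have [a [b [ab eE]]] : exists a b, a != b /\ e = [set a; b]%SET by apply/cards2P/eqP.
have ae : a \in e by rewrite eE !finset.inE eqxx.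
have be : b \in e by rewrite eE !finset.inE eqxx orbT.
have eP k : k \in e -> k = a \/ k = b.
  by rewrite eE !finset.inE => /orP[]/eqP; [left|right].
have [at_ bt] := (fintype.subsetP et a ae, fintype.subsetP et b be).
have [d [dt da db dP]] := third_vertex t3 at_ bt ab.
pose P := [set w | e \subset supp w] `&` range (q i).
have disc : disc_at R P y.
  case: qy => x _ qx; rewrite /P -qx; apply: (piece_disc strat).
  by apply: (star_nbhs hK); rewrite qx ye.
(* Without a second triangle, the piece near [e] consists of points of [e] and of [t] only. *)
have Pt w : P w -> supp w \subset t.
  move=> [/= ew qw]; have := supp_le3 w; rewrite leq_eqVlt => /orP[/eqP w3|w2].
    have wT : supp w \in piece_triangles i by apply/in_piece_triangles; exists w.
    have [->//|wt] := eqVneq (supp w) t.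
    by have := nE (supp w); rewrite wT wt ew; case.
  by have /eqP <- : e == supp w by rewrite eqEcard ew e2.
(* The coordinate at [d], the vertex opposite to [e], is nonnegative and vanishes at [y]. *)
apply: (@not_nbhs_halfplane R (h y 0 a, h y 0 d) ((fun w => (h w 0 a, h w 0 d)) @` P)).
- rewrite /= coord_out// ye; apply/negP => /eP[dE|dE].
    by rewrite dE eqxx in da.
  by rewrite dE eqxx in db.
- by move=> _ [w _ <-]; rewrite /halfplane /=; exact: coord_ge0 hK _ _.
- apply: (invariance_of_domain (g := fun w => (h w 0 a, h w 0 d)) disc).
    by apply: continuous_subspaceT; exact: coord_pair_continuous hK a d.
  move=> w w'; rewrite !inE => /Pt wt /Pt wt' [Ea Ed].
  apply: (real_ext hK (d := b)) => k kb; have [kt|kt] := boolP (k \in t).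
    by case: (dP k kt) => [->|kE|->] //; rewrite kE eqxx in kb.
  rewrite !(coord_out (h := h))//; apply: contra kt => kw.
    exact: (fintype.subsetP wt').
  exact: (fintype.subsetP wt).
Qed.

Lemma piece_critical (f : {set 'I_N} -> R) i : discrete_morse K f ->
  exists t, [/\ t \in piece_triangles i, t \in K, #|t| = 3 & critical K f t].
Proof.
move=> fM; have [z [qz z3]] := piece_has_triangle i.
have T0 : supp z \in piece_triangles i by apply/in_piece_triangles; exists z.
case: (Order.TotalTheory.arg_maxP f T0) => t tT tmax.
have [y [yt t3 qy]] := (in_piece_triangles i t).1 tT.
exists t; split => //; first by rewrite -yt supp_K.
apply/andP; split; rewrite cards_eq0 -finset.subset0; apply/fintype.subsetP => s;
  rewrite !finset.inE.
  case/andP => sK /andP[/andP[_ /eqP s4] _].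
  by have := card_simplex_le3 strat simpK hK sK; rewrite s4 t3.
case/andP => sK /andP[/andP[st /eqP s3] fts].
have s2 : #|s| = 2 by move: s3; rewrite t3 => -[].
have [t' [tT' tt' st']] := edge_in_other_triangle tT st s2.
have [y' [yt' t3' _]] := (in_piece_triangles i t').1 tT'.
have [+ _] := fM s sK; rewrite leqNgt => /negP; case.
(* Both cofaces violate the Morse condition at [s], as [f t' <= f t <= f s]. *)
apply/card_gt1P; exists t', t; split => //; rewrite !finset.inE.
  rewrite -{1}yt' (supp_K hK) st' t3' s2 eqxx /=.
  by apply: le_trans fts; exact: tmax.
by rewrite -{1}yt (supp_K hK) st t3 s2 eqxx.
Qed.

End Faces.

Theorem theorem15 (R : realType) (X : topologicalType) (n m : nat)
    (M : 'I_n -> topologicalType)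
    (phi : forall i, M i -> 'I_m * (R * R))
    (q : forall i, M i -> X) (c : 'I_m -> R * R -> X)
    (N : nat) (K : {set {set 'I_N}}) (h : X -> 'rV[R]_N)
    (f : {set 'I_N} -> R) :
  twisted_2_stratifold phi q c ->
  simplicial_complex K ->
  homeo_onto [set: X] h (@geom_real R N K) ->
  discrete_morse K f ->
  (n <= m2 K f)%N.
Proof.
move=> strat simpK hK fM.
have /choice[t tP] := fun i => piece_critical strat simpK hK i fM.
have tinj : injective t.
  move=> i j tij; have [ti _ _ _] := tP i; have [tj _ _ _] := tP j.
  by rewrite -tij in tj; exact: (piece_triangles_disjoint strat simpK hK ti tj).
rewrite -[X in (X <= _)%N]card_ord -cardsT -(card_imset _ tinj).
apply/subset_leq_card/fintype.subsetP => _ /imsetP[i _ ->].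
by have [_ tK t3 tc] := tP i; rewrite finset.inE tK t3 tc.
Qed.
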